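(* Let $\mathcal{C}$ be a completion-post-effective, $\infty$-completion-effective and positive-effective class of positive very-WSTS. Then the repeated coverability problem is decidable for $\mathcal{C}$: given $\mathcal{S}=(X,\xrightarrow{\Sigma},\le)\in\mathcal{C}$ and $x,y\in X$, one can decide whether $y$ is repeatedly coverable from $x$.
   Context: A (labeled, ordered) transition system is $\mathcal{S}=(X,\xrightarrow{\Sigma},\le)$: $X$ a set, $\Sigma$ a finite alphabet, $\xrightarrow{a}\subseteq X\times X$, $\le$ a quasi-ordering; relations extend to words. $\mathrm{Post}(x,w)=\{y:x\xrightarrow{w}y\}$, extended to sets by union; $\downarrow D=\{x:\exists y\in D,\,x\le y\}$. WSTS: $\le$ a wqo and $x\xrightarrow{a}y$, $x'\ge x$ imply $x'\xrightarrow{w}y'\ge y$ for some $w$. Strong monotonicity: $x\xrightarrow{a}y$, $x'\ge x$ imply $x'\xrightarrow{a}y'$ with $y'\ge y$; strong-strict: additionally $x'>x$ gives $y'>y$. Deterministic: at most one $a$-successor. Ideals: nonempty downward-closed directed subsets, set $\mathrm{Idl}(X)$. Completion $\widehat{\mathcal{S}}=(\mathrm{Idl}(X),\Rightarrow_\Sigma,\subseteq)$ with $I\xRightarrow{a}J$ iff $J$ is a $\subseteq$-maximal ideal included in $\downarrow\mathrm{Post}(I,a)$; if deterministic, $w(I)$ is the unique $J$ with $I\xRightarrow{w}J$. $w^\infty(I)=\bigcup_kw^k(I)$ if $I\subset w(I)$, else $I$. Levels: $\mathrm{Idl}_0(X)=\mathrm{Idl}(X)$, $\mathrm{Idl}_n(X)$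 = unions of strictly increasing sequences in $\mathrm{Idl}_{n-1}(X)$; finitely many levels if some $\mathrm{Idl}_n(X)=\emptyset$. Very-WSTS: WSTS with strong monotonicity whose completion is a deterministic WSTS ($\subseteq$ a wqo on ideals) with strong-strict monotonicity, and $\mathrm{Idl}(X)$ has finitely many levels. Positivity: $w$ is positive for $x$ if $x\xrightarrow{w}z$ for some $z\ge x$; $w$ is positive if positive for every $x$ with $\mathrm{Post}(x,w)\ne\emptyset$; $\mathcal{S}$ is positive if every word positive for some state is positive. $y$ is repeatedly coverable from $x$ if there are $z_0,z_1,\dots$ with $x\xrightarrow{*}z_0\xrightarrow{+}z_1\xrightarrow{+}\cdots$ and $z_i\ge y$ for all $i$. Effectiveness: a class is completion-post-effective if ideals can be effectively represented and manipulated, inclusion of ideals is decidable, and the completion successors of any ideal are computable; $\infty$-completion-effective if $w^\infty(I)$ is computable for every ideal $I$ and word $w$; positive-effective if there is an algorithm deciding, given $\mathcal{S}\in\mathcal{C}$ and a finite automaton $A$ over $\Sigma$, whether the language of $A$ contains a positive word. *)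

(* Defs.v *)
From Stdlib Require Import List Arith.
Import ListNotations.

Inductive prog : Type :=
| PZero
| PSucc
| PProj (i : nat)
| PComp (f : prog) (gs : list prog)
| PRec (f g : prog)
| PMin (f : prog).

Inductive eval : prog -> list nat -> nat -> Prop :=
| eZero xs : eval PZero xs 0
| eSucc xs : eval PSucc xs (S (hd 0 xs))
| eProj i xs : eval (PProj i) xs (nth i xs 0)
| eComp f gs xs ys r :
    evals gs xs ys -> eval f ys r -> eval (PComp f gs) xs r
| eRec0 f g xs r : eval f xs r -> eval (PRec f g) (0 :: xs) r
| eRecS f g n xs r r' :
    eval (PRec f g) (n :: xs) r -> eval g (n :: r :: xs) r' ->
    eval (PRec f g) (S n :: xs) r'
| eMin f xs n :
    eval f (n :: xs) 0 ->
    (forall m, m < n -> exists k, eval f (m :: xs) (S k)) ->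
    eval (PMin f) xs n
with evals : list prog -> list nat -> list nat -> Prop :=
| esNil xs : evals [] xs []
| esCons g gs xs y ys : eval g xs y -> evals gs xs ys -> evals (g :: gs) xs (y :: ys).

Definition npair (x y : nat) : nat := (x + y) * (x + y + 1) / 2 + y.

Fixpoint enc_list (l : list nat) : nat :=
  match l with
  | [] => 0
  | x :: l' => S (npair x (enc_list l'))
  end.

Definition bool_nat (b : bool) : nat := if b then 1 else 0.

(** A labeled ordered transition system; the alphabet is {0,...,nsig-1}. *)
Record TS : Type := mkTS {
  St : Type;
  nsig : nat;
  tr : nat -> St -> St -> Prop;
  le : St -> St -> Prop
}.

Definition step (Y : TS) (a : nat) (x y : St Y) : Prop := a < nsig Y /\ tr Y a x y.

Fixpoint steps {T : Type} (st : nat -> T -> T -> Prop) (w : list nat) (x y : T) : Prop :=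
  match w with
  | [] => x = y
  | a :: w' => exists z, st a x z /\ steps st w' z y
  end.

Definition quasi_order {T : Type} (D : T -> Prop) (le : T -> T -> Prop) : Prop :=
  (forall x, D x -> le x x) /\
  (forall x y z, D x -> D y -> D z -> le x y -> le y z -> le x z).

Definition wqo {T : Type} (D : T -> Prop) (le : T -> T -> Prop) : Prop :=
  quasi_order D le /\
  forall f : nat -> T, (forall n, D (f n)) -> exists i j, i < j /\ le (f i) (f j).

Definition lt_of {T : Type} (le : T -> T -> Prop) (x y : T) : Prop := le x y /\ ~ le y x.

Definition monotone {T : Type} (D : T -> Prop) (st : nat -> T -> T -> Prop)
  (le : T -> T -> Prop) : Prop :=
  forall a x y x', D x -> D x' -> st a x y -> le x x' ->
    exists w y', steps st w x' y' /\ le y y'.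

Definition is_wsts {T : Type} (D : T -> Prop) (st : nat -> T -> T -> Prop)
  (le : T -> T -> Prop) : Prop :=
  wqo D le /\ monotone D st le.

Definition strongly_monotone {T : Type} (D : T -> Prop) (st : nat -> T -> T -> Prop)
  (le : T -> T -> Prop) : Prop :=
  forall a x y x', D x -> D x' -> st a x y -> le x x' ->
    exists y', st a x' y' /\ le y y'.

Definition strongly_strictly_monotone {T : Type} (D : T -> Prop)
  (st : nat -> T -> T -> Prop) (le : T -> T -> Prop) : Prop :=
  forall a x y x', D x -> D x' -> st a x y -> le x x' ->
    exists y', st a x' y' /\ le y y' /\ (lt_of le x x' -> lt_of le y y').

Definition deterministic {T : Type} (D : T -> Prop) (st : nat -> T -> T -> Prop)
  (le : T -> T -> Prop) : Prop :=
  forall a x y1 y2, D x -> st a x y1 -> st a x y2 -> le y1 y2 /\ le y2 y1.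

Definition allX {T : Type} (_ : T) : Prop := True.

Definition incl {T : Type} (A B : T -> Prop) : Prop := forall x, A x -> B x.
Definition seteq {T : Type} (A B : T -> Prop) : Prop := incl A B /\ incl B A.

Definition is_ideal (Y : TS) (I : St Y -> Prop) : Prop :=
  (exists x, I x) /\
  (forall x y, le Y x y -> I y -> I x) /\
  (forall x y, I x -> I y -> exists z, I z /\ le Y x z /\ le Y y z).

Definition downPost (Y : TS) (I : St Y -> Prop) (a : nat) : St Y -> Prop :=
  fun x => exists i y, I i /\ step Y a i y /\ le Y x y.

Definition cstep (Y : TS) (a : nat) (I J : St Y -> Prop) : Prop :=
  is_ideal Y J /\ incl J (downPost Y I a) /\
  forall K, is_ideal Y K -> incl J K -> incl K (downPost Y I a) -> incl K J.

Fixpoint level (Y : TS) (n : nat) (I : St Y -> Prop) : Prop :=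
  match n with
  | 0 => is_ideal Y I
  | S n' => exists f : nat -> (St Y -> Prop),
      (forall k, level Y n' (f k)) /\
      (forall k, lt_of incl (f k) (f (S k))) /\
      (forall x, I x <-> exists k, f k x)
  end.

Definition finitely_many_levels (Y : TS) : Prop :=
  exists n, forall I, ~ level Y n I.

Definition very_wsts (Y : TS) : Prop :=
  is_wsts allX (step Y) (le Y) /\
  strongly_monotone allX (step Y) (le Y) /\
  is_wsts (is_ideal Y) (cstep Y) incl /\
  deterministic (is_ideal Y) (cstep Y) incl /\
  strongly_strictly_monotone (is_ideal Y) (cstep Y) incl /\
  finitely_many_levels Y.

Fixpoint wpow (w : list nat) (k : nat) : list nat :=
  match k with 0 => [] | S k' => w ++ wpow w k' end.

Definition winf (Y : TS) (w : list nat) (I J : St Y -> Prop) : Prop :=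
  let grows := exists J1, steps (cstep Y) w I J1 /\ lt_of incl I J1 in
  (grows /\ forall x, J x <-> exists k K, steps (cstep Y) (wpow w k) I K /\ K x)
  \/ (~ grows /\ seteq J I).

Definition positive_for (Y : TS) (w : list nat) (x : St Y) : Prop :=
  exists z, steps (step Y) w x z /\ le Y x z.

Definition positive_word (Y : TS) (w : list nat) : Prop :=
  forall x, (exists y, steps (step Y) w x y) -> positive_for Y w x.

Definition positive_ts (Y : TS) : Prop :=
  forall w, (exists x, positive_for Y w x) -> positive_word Y w.

Definition repeatedly_coverable (Y : TS) (x y : St Y) : Prop :=
  exists z : nat -> St Y,
    (exists w, steps (step Y) w x (z 0)) /\
    (forall i, exists w, w <> [] /\ steps (step Y) w (z i) (z (S i))) /\
    (forall i, le Y y (z i)).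

Record automaton : Type := mkAut {
  a_init : list nat;
  a_final : list nat;
  a_delta : list (nat * nat * nat)
}.

Inductive arun (A : automaton) : nat -> list nat -> nat -> Prop :=
| arun_nil q : arun A q [] q
| arun_cons q a q' w r : In (q, a, q') (a_delta A) -> arun A q' w r -> arun A q (a :: w) r.

Definition in_lang (A : automaton) (w : list nat) : Prop :=
  exists q0 qf, In q0 (a_init A) /\ In qf (a_final A) /\ arun A q0 w qf.

Definition over_alphabet (n : nat) (A : automaton) : Prop :=
  forall q a q', In (q, a, q') (a_delta A) -> a < n.

Definition enc_aut (A : automaton) : nat :=
  npair (enc_list (a_init A))
    (npair (enc_list (a_final A))
       (enc_list (map (fun t => match t with (q, a, q') => npair q (npair a q') end)
                      (a_delta A)))).

(** A class: descriptions d (natural numbers) with [inC d] are the members,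
    [sys d] is the system described; states and ideals of [sys d] are
    represented by natural-number codes (partial decoding functions). *)
Record ts_class : Type := mkClass {
  inC : nat -> Prop;
  sys : nat -> TS;
  st_of : forall d, nat -> option (St (sys d));
  idl_of : forall d, nat -> option (St (sys d) -> Prop)
}.

Definition valid_representation (C : ts_class) : Prop :=
  forall d, inC C d ->
    (forall x, exists c, st_of C d c = Some x) /\
    (forall c I, idl_of C d c = Some I -> is_ideal (sys C d) I) /\
    (forall I, is_ideal (sys C d) I -> exists c J, idl_of C d c = Some J /\ seteq J I).

Definition completion_post_effective (C : ts_class) : Prop :=
  valid_representation C /\
  (exists p, forall d, inC C d -> eval p [d] (nsig (sys C d))) /\
  (exists p, forall d, inC C d -> forall cx x, st_of C d cx = Some x ->
     exists c I, eval p [d; cx] c /\ idl_of C d c = Some I /\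
       seteq I (fun z => le (sys C d) z x)) /\
  (exists p, forall d, inC C d -> forall ci cj I J,
     idl_of C d ci = Some I -> idl_of C d cj = Some J ->
     (incl I J /\ eval p [d; ci; cj] 1) \/ (~ incl I J /\ eval p [d; ci; cj] 0)) /\
  (* completion successors are computable: output 0 = no successor,
     S c = the (unique up to equality) successor with code c *)
  (exists p, forall d, inC C d -> forall ci I a, idl_of C d ci = Some I ->
     a < nsig (sys C d) ->
     ((~ exists J, cstep (sys C d) a I J) /\ eval p [d; ci; a] 0) \/
     (exists c J, eval p [d; ci; a] (S c) /\ idl_of C d c = Some J /\
                  cstep (sys C d) a I J)).

Definition infinity_completion_effective (C : ts_class) : Prop :=
  exists p, forall d, inC C d -> forall ci I w, idl_of C d ci = Some I ->
    (forall a, In a w -> a < nsig (sys C d)) ->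
    exists c J, eval p [d; ci; enc_list w] c /\ idl_of C d c = Some J /\
      winf (sys C d) w I J.

Definition positive_effective (C : ts_class) : Prop :=
  exists p, forall d, inC C d -> forall A, over_alphabet (nsig (sys C d)) A ->
    let P := exists w, in_lang A w /\ positive_word (sys C d) w in
    (P /\ eval p [d; enc_aut A] 1) \/ (~ P /\ eval p [d; enc_aut A] 0).

Definition repeated_coverability_decidable (C : ts_class) : Prop :=
  exists p, forall d, inC C d -> forall cx cy x y,
    st_of C d cx = Some x -> st_of C d cy = Some y ->
    (repeatedly_coverable (sys C d) x y /\ eval p [d; cx; cy] 1) \/
    (~ repeatedly_coverable (sys C d) x y /\ eval p [d; cx; cy] 0).

(* Main.v *)
Require Import Defs.
From Stdlib Require Import List Arith Lia Bool.
From Stdlib Require Import ClassicalEpsilon FunctionalExtensionality PropExtensionality.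
Import Defs ListNotations.

(** Writing [D] for the downward closure of [Post*(x)], determinism of the completion makes
    every nonempty [downPost I a] an ideal, the only successor of [I].  Karp-Miller
    acceleration therefore yields a finite set [F] of ideals included in [D], each obtained
    from the ideal below [x] by successors and accelerations, that covers [x] and is closed
    under successors up to inclusion, whence [D] is the union of [F].  By positivity, [y] is
    repeatedly coverable from [x] iff a nonempty positive word [w] is enabled at some [z] in
    [D] above [y].  If [z] lies in a maximal ideal [K] of [F] then [w(K)] contains [K], hence
    equals [K], and by strict monotonicity all ideals met on the way are maximal too, so [w]
    labels a loop of exact completion steps inside [F].  Such loops form a regular language,
    to which the positivity oracle applies.  The ideals that can be derived from the one below
    [x] are enumerated by lists of instructions, so [F] is found by unbounded search. *)

(** The Karp-Miller tree is never computed: its termination combines the wqo on ideals with the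
    bound on levels, and neither yields a number that a program could use. The tree only proves that
    the search ends. What the search tests is decidable and certifies itself: a family that covers
    the ideal below [x] and is closed up to inclusion covers [D] by induction on runs, while
    derivability of its members gives the other inclusion. Closure up to inclusion is enough for [F]
    but not for the loops: replacing a successor by a larger ideal could enable letters that are
    disabled along [w] from [K], and a positive word need not be enabled anywhere in [K]. Exact
    steps ensure that the word of the loop is enabled. On the computational side, [eval] is partial
    and the oracles may diverge on invalid codes, so every program is shown to converge relative to
    a domain and every oracle call is guarded. *)

Lemma set_ext {T : Type} (A B : T -> Prop) : incl A B -> incl B A -> A = B.
Proof.
  intros H1 H2. apply functional_extensionality. intros x.
  apply propositional_extensionality. split; auto.
Qed.

(** * Well-quasi-orders *)

Fixpoint bad {T : Type} (le : T -> T -> Prop) (s : list T) : Prop :=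
  match s with
  | [] => True
  | x :: s' => bad le s' /\ forall y, In y s' -> ~ le y x
  end.

(** Bad sequences, listed with the newest element first, cannot be extended forever. If [P] failed
    at [s0], the hypothesis would always provide one more element with [P] still failing, and
    dependent choice would produce an infinite bad sequence. *)
Lemma bad_induction {T : Type} (D : T -> Prop) (le : T -> T -> Prop) (P : list T -> Prop) :
  wqo D le ->
  (forall s, bad le s -> Forall D s ->
     (forall x, D x -> bad le (x :: s) -> P (x :: s)) -> P s) ->
  forall s, bad le s -> Forall D s -> P s.
Proof.
  intros [_ Hw] Hstep s0 Hb0 HD0. apply NNPP. intros Hn.
  set (Q := fun s => bad le s /\ Forall D s /\ ~ P s).
  assert (Hnext : forall s : {s | Q s}, {x | Q (x :: proj1_sig s)}).
  { intros [s [Hb [HD HP]]]. apply constructive_indefinite_description.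
    apply NNPP. intros Hno. apply HP, Hstep; trivial.
    intros x Hx Hbx. apply NNPP. intros HPx. apply Hno. exists x.
    unfold Q. repeat split; try apply Hbx; auto. }
  set (nxt := fun s : {s | Q s} =>
    exist Q (proj1_sig (Hnext s) :: proj1_sig s) (proj2_sig (Hnext s))).
  set (sq := fix sq n := match n with
    | 0 => exist Q s0 (conj Hb0 (conj HD0 Hn)) | S n' => nxt (sq n') end).
  set (f := fun n => proj1_sig (Hnext (sq n))).
  assert (Hin : forall i j, i < j -> In (f i) (proj1_sig (sq j))).
  { intros i j Hij. induction Hij as [|j Hij IH].
    - left. reflexivity.
    - right. exact IH. }
  destruct (Hw f) as [i [j [Hij Hle]]].
  - intros n. pose proof (proj2_sig (Hnext (sq n))) as [_ [HD _]].
    inversion HD; assumption.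
  - pose proof (proj2_sig (Hnext (sq j))) as [[_ Hb] _].
    exact (Hb _ (Hin i j Hij) Hle).
Qed.

Lemma list_maximal {T : Type} (le : T -> T -> Prop) (l : list T) (x : T) :
  (forall x, le x x) -> (forall x y z, le x y -> le y z -> le x z) -> In x l ->
  exists m, In m l /\ le x m /\ forall y, In y l -> le m y -> le y m.
Proof.
  intros Hr Ht. revert x. induction l as [|a l IH]; intros x Hx; [easy|].
  assert (Hl : forall y, In y l -> exists m, In m (a :: l) /\ le y m /\
      forall z, In z (a :: l) -> le m z -> le z m).
  { intros y Hy. destruct (IH y Hy) as [m [Hm [Hym Hmax]]].
    destruct (classic (le m a)) as [Hma|Hma].
    - exists a. split; [now left|]. split; [eauto|].
      intros z [<-|Hz] Haz; [trivial|]. apply Ht with m; eauto.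
    - exists m. split; [now right|]. split; trivial.
      intros z [<-|Hz] Hmz; [contradiction|auto]. }
  destruct Hx as [<-|Hx]; [|auto].
  destruct (classic (exists y, In y l /\ le a y)) as [[y [Hy Hay]]|Hno].
  - destruct (Hl y Hy) as [m [Hm [Hym Hmax]]]. exists m. eauto.
  - exists a. split; [now left|]. split; trivial.
    intros z [<-|Hz] Haz; trivial. exfalso. eauto.
Qed.

(** * Ideals of a well-quasi-ordered state space *)

Definition down_closed (Y : TS) (U : St Y -> Prop) : Prop :=
  forall x y, le Y x y -> U y -> U x.

Definition below (Y : TS) (x : St Y) : St Y -> Prop := fun z => le Y z x.

Lemma ideal_down_closed (Y : TS) (I : St Y -> Prop) : is_ideal Y I -> down_closed Y I.
Proof. now intros [_ [Hd _]]. Qed.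

(** Ideals are irreducible. If some [x] in [I] lies outside [A], every [z] in [I] has a common upper
    bound with [x] inside [I]; that bound is outside [A] as well, so the remaining sets already
    cover [I]. *)
Lemma ideal_in_union (Y : TS) (I : St Y -> Prop) (l : list (St Y -> Prop)) :
  is_ideal Y I -> Forall (down_closed Y) l ->
  (forall x, I x -> exists J, In J l /\ J x) -> exists J, In J l /\ incl I J.
Proof.
  intros [[x0 Hx0] [Hd Hdir]]. induction l as [|A l IH]; intros Hl Hc.
  - destruct (Hc _ Hx0) as [J [[] _]].
  - inversion Hl as [|? ? HA Hl']; subst.
    destruct (classic (incl I A)) as [H|H]; [exists A; split; [now left|trivial]|].
    assert (exists x, I x /\ ~ A x) as [x [HIx HAx]].
    { apply NNPP. intros Hn. apply H. intros x Hx. apply NNPP. eauto. }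
    destruct IH as [J [HJ HIJ]]; trivial.
    + intros z Hz. destruct (Hdir _ _ HIx Hz) as [v [Hv [Hxv Hzv]]].
      destruct (Hc v Hv) as [J [[<-|HJ] HJv]].
      * exfalso. eauto.
      * exists J. split; trivial. rewrite Forall_forall in Hl'. eapply Hl'; eauto.
    + exists J. split; [now right|trivial].
Qed.

Section WellQuasiOrdered.

Variable Y : TS.
Hypothesis Hwqo : wqo allX (le Y).

Lemma le_refl x : le Y x x.
Proof. now apply Hwqo. Qed.

Lemma le_trans x y z : le Y x y -> le Y y z -> le Y x z.
Proof. now apply Hwqo. Qed.

Lemma below_ideal x : is_ideal Y (below Y x).
Proof.
  split; [exists x; apply le_refl|]. split.
  - intros u v Huv Hv. exact (le_trans _ _ _ Huv Hv).
  - intros u v Hu Hv. exists x. split; [apply le_refl|split; trivial].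
Qed.

(* Induction on the bad sequence [s] of minimal excluded elements: if the part of [U]
   above no element of [s] is not directed, as witnessed by [x] and [y], then it is the
   union of the parts that in addition exclude [x], respectively [y]. *)
Lemma ideal_decomposition (U : St Y -> Prop) :
  down_closed Y U ->
  exists l, Forall (is_ideal Y) l /\ forall x, U x <-> exists I, In I l /\ I x.
Proof.
  intros HU.
  set (V := fun s z => U z /\ forall y, In y s -> ~ le Y y z).
  cut (exists l, Forall (is_ideal Y) l /\ forall x, V [] x <-> exists I, In I l /\ I x).
  { intros [l [Hl H]]. exists l. split; trivial. intros x. rewrite <- H.
    unfold V. simpl. firstorder. }
  apply (bad_induction allX (le Y)
    (fun s => exists l, Forall (is_ideal Y) l /\ forall x, V s x <-> exists I, In I l /\ I x));
    simpl; trivial.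
  intros s Hb _ IH.
  destruct (classic (exists x, V s x)) as [Hne|He].
  2:{ exists []. split; [constructor|]. intros x. split; [|firstorder].
      intros Hx. exfalso. eauto. }
  destruct (classic (forall x y, V s x -> V s y ->
      exists z, V s z /\ le Y x z /\ le Y y z)) as [Hdir|Hdir].
  { exists [V s]. split.
    - constructor; [|constructor]. split; [trivial|]. split; [|trivial].
      intros x y Hxy [Hy Hys]. split; [eauto|].
      intros z Hz Hzx. apply (Hys z Hz). exact (le_trans _ _ _ Hzx Hxy).
    - intros x. split.
      + intros Hx. exists (V s). split; [now left|trivial].
      + intros [I [[<-|[]] Hx]]. trivial. }
  assert (exists x y, V s x /\ V s y /\ ~ exists z, V s z /\ le Y x z /\ le Y y z)
    as [x [y [Hx [Hy Hxy]]]].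
  { apply NNPP. intros Hn. apply Hdir. intros x y Hx Hy. apply NNPP. intros Hz.
    apply Hn. eauto. }
  (* That [x] satisfies the second half of [V s] is exactly what keeps [x :: s] bad; likewise for
     [y]. *)
  destruct (IH x) as [l1 [Hl1 H1]]; [exact Logic.I|split; [trivial|apply Hx]|].
  destruct (IH y) as [l2 [Hl2 H2]]; [exact Logic.I|split; [trivial|apply Hy]|].
  exists (l1 ++ l2). split; [now apply Forall_app|]. intros z. split.
  - intros Hz. destruct (classic (le Y x z)) as [Hxz|Hxz].
    + destruct (proj1 (H2 z)) as [I [HI HIz]].
      * destruct Hz as [HUz Hs]. split; trivial. intros u [<-|Hu]; auto.
        intros Hyz. apply Hxy. exists z. firstorder.
      * exists I. split; trivial. apply in_or_app. now right.
    + destruct (proj1 (H1 z)) as [I [HI HIz]].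
      * destruct Hz as [HUz Hs]. split; trivial. intros u [<-|Hu]; auto.
      * exists I. split; trivial. apply in_or_app. now left.
  - intros [I [HI HIz]]. apply in_app_or in HI. destruct HI as [HI|HI].
    + destruct (proj2 (H1 z)) as [HUz Hs]; [eauto|]. split; trivial. firstorder.
    + destruct (proj2 (H2 z)) as [HUz Hs]; [eauto|]. split; trivial. firstorder.
Qed.

End WellQuasiOrdered.

(** * The completion of a very-WSTS *)

(** A total function on arbitrary sets: a disabled word gives the empty set, so nonemptiness stands
    for enabledness from here on. *)
Fixpoint wpost (Y : TS) (w : list nat) (I : St Y -> Prop) : St Y -> Prop :=
  match w with
  | [] => I
  | a :: w' => wpost Y w' (downPost Y I a)
  end.

(** The set [D] of the overview. *)
Definition coverable (Y : TS) (x : St Y) : St Y -> Prop :=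
  fun z => exists w z', steps (step Y) w x z' /\ le Y z z'.

Inductive derived (Y : TS) (x : St Y) : (St Y -> Prop) -> Prop :=
| derived_root : derived Y x (below Y x)
| derived_step a I J : derived Y x I -> cstep Y a I J -> derived Y x J
| derived_winf w I J : (forall a, In a w -> a < nsig Y) ->
    derived Y x I -> winf Y w I J -> derived Y x J.

Definition covers {T : Type} (F : list (T -> Prop)) (A : T -> Prop) : Prop :=
  exists L, In L F /\ incl A L.

Definition post_closed (Y : TS) (F : list (St Y -> Prop)) : Prop :=
  forall K a, In K F -> (exists z, downPost Y K a z) -> covers F (downPost Y K a).

Lemma covers_sub {T : Type} (F G : list (T -> Prop)) (A : T -> Prop) :
  (forall L, In L F -> In L G) -> covers F A -> covers G A.
Proof. intros H [L [HL HA]]. exists L. auto. Qed.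

Lemma steps_app {T : Type} (st : nat -> T -> T -> Prop) (u v : list nat) (x z : T) :
  steps st (u ++ v) x z <-> exists y, steps st u x y /\ steps st v y z.
Proof.
  revert x. induction u as [|a u IH]; intros x; simpl.
  - split; [eauto|]. intros [y [-> H]]. trivial.
  - split.
    + intros [y [Hy H]]. apply IH in H. destruct H as [t [H1 H2]]. eauto.
    + intros [t [[y [Hy H1]] H2]]. exists y. split; trivial. apply IH. eauto.
Qed.

Lemma wpost_app (Y : TS) (u v : list nat) (I : St Y -> Prop) :
  wpost Y (u ++ v) I = wpost Y v (wpost Y u I).
Proof. revert I. induction u; simpl; auto. Qed.

Lemma downPost_mono (Y : TS) (I J : St Y -> Prop) (a : nat) :
  incl I J -> incl (downPost Y I a) (downPost Y J a).
Proof. intros H x [i [y [Hi Hy]]]. exists i, y. auto. Qed.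

Lemma wpost_mono (Y : TS) (w : list nat) (I J : St Y -> Prop) :
  incl I J -> incl (wpost Y w I) (wpost Y w J).
Proof.
  revert I J. induction w as [|a w IH]; simpl; auto using downPost_mono.
Qed.

Lemma wpost_nonempty (Y : TS) (w : list nat) (I : St Y -> Prop) :
  (exists x, wpost Y w I x) -> exists x, I x.
Proof.
  revert I. induction w as [|a w IH]; simpl; trivial.
  intros I H. destruct (IH _ H) as [z [i [y [Hi _]]]]. eauto.
Qed.

Lemma wpost_union (Y : TS) (w : list nat) (f : nat -> St Y -> Prop) (I : St Y -> Prop) :
  (forall x, I x <-> exists k, f k x) ->
  forall x, wpost Y w I x <-> exists k, wpost Y w (f k) x.
Proof.
  revert f I. induction w as [|a w IH]; simpl; trivial.
  intros f I H. apply (IH (fun k => downPost Y (f k) a)). intros x. split.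
  - intros [i [y [Hi Hy]]]. apply H in Hi. destruct Hi as [k Hk]. exists k, i, y. auto.
  - intros [k [i [y [Hi Hy]]]]. exists i, y. split; trivial. apply H. eauto.
Qed.

Lemma increasing_incl {T : Type} (f : nat -> T -> Prop) :
  (forall k, incl (f k) (f (S k))) -> forall i j, i <= j -> incl (f i) (f j).
Proof. intros H i j Hij. induction Hij; intros x Hx; [trivial|apply H; auto]. Qed.

Lemma level_ideal (Y : TS) (n : nat) (I : St Y -> Prop) : level Y n I -> is_ideal Y I.
Proof.
  revert I. induction n as [|n IH]; simpl; trivial.
  intros I [f [Hf [Hlt Hun]]].
  assert (Hinc := increasing_incl f (fun k => proj1 (Hlt k))).
  split; [|split].
  - destruct (IH _ (Hf 0)) as [[x Hx] _]. exists x. apply Hun. eauto.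
  - intros x y Hxy Hy. apply Hun in Hy. destruct Hy as [k Hk]. apply Hun. exists k.
    destruct (IH _ (Hf k)) as [_ [Hd _]]. eauto.
  - intros x y Hx Hy. apply Hun in Hx. apply Hun in Hy.
    destruct Hx as [i Hi], Hy as [j Hj].
    destruct (IH _ (Hf (max i j))) as [_ [_ Hdir]].
    destruct (Hdir x y) as [z [Hz Hxy]].
    + apply (Hinc i); [lia|trivial].
    + apply (Hinc j); [lia|trivial].
    + exists z. split; trivial. apply Hun. eauto.
Qed.

Section VeryWSTS.

Variable Y : TS.
Hypothesis Hvery : very_wsts Y.

Let Hwqo : wqo allX (le Y) := proj1 (proj1 Hvery).

Lemma steps_mono w x y x' :
  steps (step Y) w x y -> le Y x x' -> exists y', steps (step Y) w x' y' /\ le Y y y'.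
Proof.
  pose proof Hvery as [_ [Hm _]].
  revert x x'. induction w as [|a w IH]; simpl; intros x x' H Hx.
  - subst. eauto.
  - destruct H as [z [Hz H]].
    destruct (Hm a x z x' Logic.I Logic.I Hz Hx) as [z' [Hz' Hzz]].
    destruct (IH _ _ H Hzz) as [y' [Hy' Hyy]]. eauto.
Qed.

Lemma downPost_down_closed I a : down_closed Y (downPost Y I a).
Proof.
  intros x y Hxy [i [z [Hi [Hz Hyz]]]]. exists i, z. repeat split; trivial; try apply Hz.
  eapply le_trans; eauto.
Qed.

(* All maximal members of an ideal decomposition of [downPost Y I a] are successors of [I],
   so by determinism there is only one of them. *)
Lemma downPost_cstep I a :
  is_ideal Y I -> (exists x, downPost Y I a x) -> cstep Y a I (downPost Y I a).
Proof.
  intros HI [x Hx]. pose proof Hvery as [_ [_ [_ [Hdet _]]]].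
  destruct (ideal_decomposition Y Hwqo _ (downPost_down_closed I a)) as [l [Hl Hun]].
  assert (Hmax : forall K, In K l -> exists M, In M l /\ incl K M /\ cstep Y a I M).
  { intros K HK.
    destruct (list_maximal incl l K) as [M [HM [HKM HMmax]]]; trivial; unfold incl; auto.
    exists M. split; trivial. split; trivial. rewrite Forall_forall in Hl.
    split; [auto|]. split.
    - intros z Hz. apply Hun. eauto.
    - intros L HL HML HLU.
      destruct (ideal_in_union Y L l) as [N [HN HLN]]; trivial.
      + rewrite Forall_forall. intros N HN. now apply ideal_down_closed, Hl.
      + intros z Hz. apply Hun. auto.
      + intros z Hz. apply (HMmax N HN); auto. intros t Ht. auto. }
  destruct (proj1 (Hun x) Hx) as [K [HK _]].
  destruct (Hmax K HK) as [M [HM [_ HcM]]].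
  replace (downPost Y I a) with M; trivial.
  apply set_ext; [apply HcM|].
  intros z Hz. apply Hun in Hz. destruct Hz as [L [HL Hz]].
  destruct (Hmax L HL) as [N [_ [HLN HcN]]].
  destruct (Hdet a I M N HI HcM HcN) as [_ HNM]. auto.
Qed.

Lemma cstep_downPost I J a :
  is_ideal Y I -> cstep Y a I J -> J = downPost Y I a.
Proof.
  intros HI HJ. pose proof Hvery as [_ [_ [_ [Hdet _]]]].
  assert (H : cstep Y a I (downPost Y I a)).
  { apply downPost_cstep; trivial. destruct HJ as [[[x Hx] _] [HJ _]]. eauto. }
  destruct (Hdet a I _ _ HI HJ H). now apply set_ext.
Qed.

Lemma downPost_ideal I a :
  is_ideal Y I -> (exists x, downPost Y I a x) -> is_ideal Y (downPost Y I a).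
Proof. intros HI H. apply (downPost_cstep I a HI H). Qed.

Lemma wpost_ideal w I :
  is_ideal Y I -> (exists x, wpost Y w I x) -> is_ideal Y (wpost Y w I).
Proof.
  revert I. induction w as [|a w IH]; simpl; trivial.
  intros I HI H. apply IH; trivial. apply downPost_ideal; trivial.
  eapply wpost_nonempty; eauto.
Qed.

Lemma steps_cstep w I J :
  is_ideal Y I ->
  (steps (cstep Y) w I J <-> J = wpost Y w I /\ exists x, wpost Y w I x).
Proof.
  revert I. induction w as [|a w IH]; simpl; intros I HI.
  - split; [|intuition]. intros <-. split; [trivial|apply HI].
  - split.
    + intros [K [HK H]].
      assert (HiK : is_ideal Y K) by apply HK.
      rewrite (cstep_downPost _ _ _ HI HK) in *. now apply IH.
    + intros [-> Hx].
      assert (Hne := wpost_nonempty _ _ _ Hx).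
      exists (downPost Y I a). split; [now apply downPost_cstep|].
      apply IH; auto. now apply downPost_ideal.
Qed.

(** Strong-strict monotonicity speaks of some successor of [J]; by determinism this is
    [downPost Y J a], so strictness propagates letter by letter. *)
Lemma wpost_strict w I J :
  is_ideal Y I -> is_ideal Y J -> lt_of incl I J -> (exists x, wpost Y w I x) ->
  lt_of incl (wpost Y w I) (wpost Y w J).
Proof.
  pose proof Hvery as [_ [_ [_ [_ [Hss _]]]]].
  revert I J. induction w as [|a w IH]; simpl; trivial.
  intros I J HI HJ HIJ Hne.
  assert (HneI := wpost_nonempty _ _ _ Hne).
  assert (HneJ : exists x, downPost Y J a x).
  { destruct HneI as [x Hx]. exists x. revert Hx. apply downPost_mono, HIJ. }
  apply IH; auto using downPost_ideal.
  destruct (Hss a I _ J HI HJ (downPost_cstep I a HI HneI) (proj1 HIJ))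
    as [K [HK [_ Hlt]]].
  rewrite (cstep_downPost _ _ _ HJ HK) in Hlt. auto.
Qed.

(** The downward closures taken after each letter can be postponed to the end: by strong
    monotonicity, a run from below a reached state lifts to a run from that state. *)
Lemma wpost_spec w I z :
  down_closed Y I ->
  (wpost Y w I z <-> exists i z', I i /\ steps (step Y) w i z' /\ le Y z z').
Proof.
  revert I. induction w as [|a w IH]; simpl; intros I HI.
  - split.
    + intros Hz. exists z, z. repeat split; trivial. now apply le_refl.
    + intros [i [z' [Hi [-> Hz]]]]. eauto.
  - rewrite IH by apply downPost_down_closed. split.
    + intros [j [z' [[i [y [Hi [Hy Hj]]]] [H Hz]]]].
      destruct (steps_mono _ _ _ _ H Hj) as [z2 [H2 Hz2]].
      exists i, z2. repeat split; trivial; [eauto|]. eapply le_trans; eauto.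
    + intros [i [z' [Hi [[y [Hy H]] Hz]]]].
      exists y, z'. repeat split; trivial. exists i, y. repeat split; trivial; try apply Hy.
      now apply le_refl.
Qed.

(** Successors commute with unions, and strict monotonicity keeps the chain that witnesses the level
    strictly increasing. *)
Lemma level_downPost n I a :
  level Y n I -> (exists x, downPost Y I a x) -> level Y n (downPost Y I a).
Proof.
  revert I. induction n as [|n IH]; [intros I HI; now apply downPost_ideal|].
  intros I [f [Hf [Hlt Hun]]] Hne. simpl.
  pose proof (wpost_union Y [a] f I Hun) as HunP. simpl in HunP.
  assert (Hinc := increasing_incl f (fun k => proj1 (Hlt k))).
  (* The letter may be disabled in the first members of the chain, so the new chain starts at an
     index [k0] where it is enabled. *)
  destruct Hne as [x Hx]. apply HunP in Hx. destruct Hx as [k0 Hx].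
  assert (Hne : forall k, exists x, downPost Y (f (k0 + k)) a x).
  { intros k. exists x. revert Hx. apply downPost_mono, Hinc. lia. }
  exists (fun k => downPost Y (f (k0 + k)) a). split; [auto|]. split.
  - intros k. apply (wpost_strict [a] (f (k0 + k)) (f (k0 + S k))).
    + exact (level_ideal _ _ _ (Hf _)).
    + exact (level_ideal _ _ _ (Hf _)).
    + rewrite Nat.add_succ_r. apply Hlt.
    + apply Hne.
  - intros z. rewrite HunP. split; [|intros [k Hk]; eauto]. intros [k Hk]. exists k.
    revert Hk. apply downPost_mono, Hinc. lia.
Qed.

(** The iterates of [w] on [I] form a strictly increasing chain of ideals of level [n], so their
    union has level [S n]. This is the measure that bounds how often accelerations can be nested. *)
Lemma winf_growing w I n :
  level Y n I -> (exists x, wpost Y w I x) -> lt_of incl I (wpost Y w I) ->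
  exists J, winf Y w I J /\ incl (wpost Y w I) J /\ level Y (S n) J.
Proof.
  intros Hl Hne Hlt.
  assert (HI := level_ideal _ _ _ Hl).
  set (f := fun k => wpost Y (wpow w k) I).
  assert (HfS : forall k, f (S k) = wpost Y (wpow w k) (wpost Y w I)).
  { intros k. unfold f. simpl. apply wpost_app. }
  assert (Hinc : forall k, incl (f k) (f (S k))).
  { intros k. rewrite HfS. apply wpost_mono, Hlt. }
  assert (Hfne : forall k, exists x, f k x).
  { intros k. destruct HI as [[x Hx] _]. exists x.
    revert Hx. apply (increasing_incl f Hinc 0 k). lia. }
  assert (Hlev : forall u K, level Y n K -> (exists x, wpost Y u K x) ->
      level Y n (wpost Y u K)).
  { induction u as [|a u IHu]; simpl; trivial. intros K HK Hx.
    apply IHu; trivial. apply level_downPost; trivial. eapply wpost_nonempty; eauto. }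
  exists (fun x => exists k, f k x). split; [|split].
  - left. split.
    + exists (wpost Y w I). split; trivial. apply steps_cstep; auto.
    + intros x. split.
      * intros [k Hk]. exists k, (f k). split; trivial. apply steps_cstep; trivial.
        split; [reflexivity|apply Hfne].
      * intros [k [K [HK Hx]]]. apply steps_cstep in HK; trivial.
        destruct HK as [-> _]. exists k. trivial.
  - intros x Hx. exists 1. rewrite HfS. trivial.
  - exists f. split; [intros k; apply Hlev; [trivial|apply Hfne]|].
    split; [|firstorder]. intros k. rewrite HfS.
    apply wpost_strict; auto using wpost_ideal. apply Hfne.
Qed.

Lemma winf_unique w I J K : winf Y w I J -> winf Y w I K -> J = K.
Proof.
  intros [[Hg1 H1]|[Hg1 H1]] [[Hg2 H2]|[Hg2 H2]]; try contradiction;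
    apply set_ext; intros x.
  - now rewrite H1, H2.
  - now rewrite H1, H2.
  - intros Hx. now apply H2, H1.
  - intros Hx. now apply H1, H2.
Qed.

Lemma winf_ideal w I J : is_ideal Y I -> winf Y w I J -> is_ideal Y J.
Proof.
  intros HI HJ.
  destruct (classic (exists J1, steps (cstep Y) w I J1 /\ lt_of incl I J1))
    as [[J1 [H1 Hlt]]|Hng].
  - apply steps_cstep in H1; trivial. destruct H1 as [-> Hne].
    destruct (winf_growing w I 0 HI Hne Hlt) as [K [HK [_ Hl]]].
    rewrite (winf_unique _ _ _ _ HJ HK). eapply level_ideal; eauto.
  - destruct HJ as [[Hg _]|[_ [H1 H2]]]; [contradiction|].
    now rewrite (set_ext J I).
Qed.

(** * Derived ideals and the Karp-Miller cover *)

Lemma derived_ideal x I : derived Y x I -> is_ideal Y I.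
Proof.
  induction 1 as [|a I J _ IH H|w I J _ _ IH H].
  - now apply below_ideal.
  - apply H.
  - eapply winf_ideal; eauto.
Qed.

Lemma wpost_coverable x w I :
  down_closed Y I -> incl I (coverable Y x) -> incl (wpost Y w I) (coverable Y x).
Proof.
  intros Hd HI z Hz. apply wpost_spec in Hz; trivial.
  destruct Hz as [i [z' [Hi [Hw Hz]]]]. destruct (HI i Hi) as [u [i' [Hu Hii]]].
  destruct (steps_mono _ _ _ _ Hw Hii) as [z2 [Hw2 Hz2]].
  exists (u ++ w), z2. split; [apply steps_app; eauto|]. eapply le_trans; eauto.
Qed.

Lemma derived_coverable x I : derived Y x I -> incl I (coverable Y x).
Proof.
  induction 1 as [|a I J HI IH H|w I J _ HI IH H].
  - intros z Hz. exists [], x. split; [reflexivity|trivial].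
  - rewrite (cstep_downPost I J a); eauto using derived_ideal.
    apply (wpost_coverable x [a]); trivial. apply ideal_down_closed, (derived_ideal _ _ HI).
  - assert (HdI := derived_ideal _ _ HI). destruct H as [[_ H]|[_ [H _]]].
    + intros z Hz. apply H in Hz. destruct Hz as [k [K [HK Hz]]].
      apply steps_cstep in HK; trivial. destruct HK as [-> _].
      revert Hz. apply wpost_coverable; trivial. now apply ideal_down_closed.
    + intros z Hz. auto.
Qed.

(* The Karp-Miller construction along the branch [s], most recent ideal first: a successor
   that contains an ideal of [s] strictly is accelerated, which raises the level; the other
   branches are bad sequences. *)
Lemma closed_cover_of_level x m : forall r I,
  (forall K, ~ level Y (r + m) K) -> derived Y x I -> level Y r I ->
  exists F, (forall K, In K F -> derived Y x K) /\ covers F I /\ post_closed Y F.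
Proof.
  induction m as [|m IHm]; intros r I0 Hr HI0 HlI0.
  { rewrite Nat.add_0_r in Hr. now apply Hr in HlI0. }
  (* The newest ideal [J] is reached from every ideal of the branch [s] by a word, the one to
     accelerate when a successor of [J] outgrows that ideal. Successors may also be covered by the
     branch itself; at the root the branch is only [[I0]], which is added to the cover at the
     end. *)
  assert (Hkm : forall s, bad incl s -> Forall (is_ideal Y) s -> forall J s', s = J :: s' ->
    (forall K, In K s -> derived Y x K /\ level Y r K /\
       exists w, (forall a, In a w -> a < nsig Y) /\ J = wpost Y w K) ->
    exists F, (forall K, In K F -> derived Y x K) /\
      forall K a, In K (J :: F) -> (exists z, downPost Y K a z) ->
        covers (F ++ s) (downPost Y K a)).
  { refine (bad_induction (is_ideal Y) incl _ _ _); [apply Hvery|].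
    intros s Hb HD IH J s' Es Hs.
    destruct (Hs J) as [HJ [HlJ _]]; [subst s; now left|].
    assert (Hone : forall a, exists F, (forall K, In K F -> derived Y x K) /\
      ((exists z, downPost Y J a z) -> covers (F ++ s) (downPost Y J a)) /\
      forall K b, In K F -> (exists z, downPost Y K b z) ->
        covers (F ++ s) (downPost Y K b)).
    { intros a.
      destruct (classic (exists z, downPost Y J a z)) as [Hne|Hne].
      2:{ exists []. simpl. repeat split; tauto. }
      assert (HiJ := derived_ideal _ _ HJ).
      assert (Ha : a < nsig Y) by (destruct Hne as [z [i [y [_ [[Ha _] _]]]]]; trivial).
      assert (Hpath : forall L, In L s -> exists w, (forall b, In b w -> b < nsig Y) /\
          downPost Y J a = wpost Y w L).
      { intros L HL. destruct (Hs L HL) as [_ [_ [w [Hw HJw]]]].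
        exists (w ++ [a]). split.
        - intros b Hb'. apply in_app_or in Hb'. destruct Hb' as [Hb'|[<-|[]]]; auto.
        - now rewrite wpost_app, <- HJw. }
      destruct (classic (exists L, In L s /\ incl L (downPost Y J a)))
        as [[L [HL HLJ]]|Hno].
      - destruct (classic (incl (downPost Y J a) L)) as [HJL|HJL].
        + exists []. simpl. repeat split; try tauto. exists L. auto.
        + destruct (Hs L HL) as [HdL [HlL _]]. destruct (Hpath L HL) as [w [Hw Hwp]].
          rewrite Hwp in *.
          destruct (winf_growing w L r HlL Hne (conj HLJ HJL)) as [W [HW [HLW HlW]]].
          (* The level rises by one and the allowance [m] drops by one, so their sum remains a level
             without ideals. *)
          destruct (IHm (S r) W) as [F [HF [[M [HM HWM]] HFc]]]; trivial.
          * intros K. rewrite Nat.add_succ_comm. apply Hr.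
          * eapply derived_winf; eauto.
          * exists F. split; trivial. split.
            -- intros _. exists M. split; [apply in_or_app; now left|].
               intros z Hz. auto.
            -- intros K b HK HKb. apply (covers_sub F); [|now apply HFc].
               intros N HN. apply in_or_app. now left.
      (* No ideal of the branch is included in the successor, so the branch extended by it is still
         bad. *)
      - assert (HcJ := downPost_cstep J a HiJ Hne).
        destruct (IH (downPost Y J a)) with (J := downPost Y J a) (s' := s)
          as [F [HF HFc]]; trivial.
        + now apply downPost_ideal.
        + split; trivial. intros L HL HLJ. apply Hno. eauto.
        + intros K [<-|HK].
          * split; [eapply derived_step; eauto|].
            split; [now apply level_downPost|]. exists []. simpl. split; tauto.
          * destruct (Hs K HK) as [HdK [HlK _]]. auto.
        + exists (downPost Y J a :: F). split; [|split].
          * intros K [<-|HK]; [eapply derived_step; eauto|auto].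
          * intros _. exists (downPost Y J a). split; [now left|]. intros z Hz. trivial.
          * intros K b HK HKb. apply (covers_sub (F ++ downPost Y J a :: s)); auto.
            intros L HL. simpl. rewrite in_app_iff in *. simpl in HL. tauto. }
    assert (Hall : forall n, exists F, (forall K, In K F -> derived Y x K) /\
      (forall a, a < n -> (exists z, downPost Y J a z) -> covers (F ++ s) (downPost Y J a)) /\
      forall K b, In K F -> (exists z, downPost Y K b z) ->
        covers (F ++ s) (downPost Y K b)).
    { induction n as [|n [F [HF [HFJ HFc]]]].
      - exists []. simpl. repeat split; try tauto. intros a Ha. lia.
      - destruct (Hone n) as [G [HG [HGJ HGc]]]. exists (F ++ G).
        assert (H1 : forall L, In L (F ++ s) -> In L ((F ++ G) ++ s))
          by (intros L; rewrite !in_app_iff; tauto).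
        assert (H2 : forall L, In L (G ++ s) -> In L ((F ++ G) ++ s))
          by (intros L; rewrite !in_app_iff; tauto).
        split; [intros K HK; apply in_app_or in HK; destruct HK; auto|]. split.
        + intros a Ha Hne. destruct (Nat.eq_dec a n) as [->|Han].
          * apply (covers_sub _ _ _ H2). auto.
          * apply (covers_sub _ _ _ H1), HFJ; trivial. lia.
        + intros K b HK HKb. apply in_app_or in HK. destruct HK as [HK|HK].
          * apply (covers_sub _ _ _ H1). auto.
          * apply (covers_sub _ _ _ H2). auto. }
    destruct (Hall (nsig Y)) as [F [HF [HFJ HFc]]]. exists F. split; trivial.
    intros K a [<-|HK] Hne; auto. apply HFJ; trivial.
    destruct Hne as [z [i [y [_ [[Ha _] _]]]]]. trivial. }
  destruct (Hkm [I0]) with (J := I0) (s' := @nil (St Y -> Prop)) as [F [HF HFc]]; trivial.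
  - simpl. tauto.
  - constructor; [|constructor]. eapply level_ideal; eauto.
  - intros K [<-|[]]. repeat split; trivial. exists []. simpl. split; tauto.
  - exists (I0 :: F). split; [|split].
    + intros K [<-|HK]; auto.
    + exists I0. split; [now left|]. intros z Hz. trivial.
    + intros K a HK Hne. apply (covers_sub (F ++ [I0])); auto.
      intros L. rewrite in_app_iff. simpl. tauto.
Qed.

Lemma closed_cover_exists x :
  exists F, (forall K, In K F -> derived Y x K) /\ covers F (below Y x) /\ post_closed Y F.
Proof.
  pose proof Hvery as [_ [_ [_ [_ [_ [N HN]]]]]].
  apply (closed_cover_of_level x N 0); trivial.
  - constructor.
  - now apply below_ideal.
Qed.

Lemma closed_cover_coverable x F :
  covers F (below Y x) -> post_closed Y F -> (forall K, In K F -> is_ideal Y K) ->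
  forall z, coverable Y x z -> exists K, In K F /\ K z.
Proof.
  intros [K0 [HK0 Hx]] Hc Hid z [w [z' [Hw Hz]]].
  cut (exists K, In K F /\ K z').
  { intros [K [HK Hz']]. exists K. split; trivial.
    apply (ideal_down_closed Y K (Hid K HK) z z'); trivial. }
  assert (Hx0 : K0 x) by (apply Hx, le_refl; trivial).
  clear z Hz Hx. revert K0 x HK0 Hw Hx0.
  induction w as [|a w IH]; simpl; intros K x' HK Hw Hx.
  - subst. eauto.
  - destruct Hw as [u [Hu Hw]].
    assert (Hdu : downPost Y K a u).
    { exists x', u. repeat split; trivial; try apply Hu. now apply le_refl. }
    destruct (Hc K a HK) as [L [HL HKL]]; eauto.
Qed.

Lemma closed_cover_ideal x F I :
  covers F (below Y x) -> post_closed Y F -> (forall K, In K F -> is_ideal Y K) ->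
  is_ideal Y I -> incl I (coverable Y x) -> covers F I.
Proof.
  intros H1 H2 H3 HI HIx. apply (ideal_in_union Y I F); trivial.
  - rewrite Forall_forall. intros K HK. apply ideal_down_closed. auto.
  - intros z Hz. apply (closed_cover_coverable x F); auto.
Qed.

(** * Repeated coverability and positive words *)

Lemma steps_loop_repeatedly_coverable x y z z' w :
  coverable Y x z -> le Y y z -> w <> [] -> positive_word Y w ->
  steps (step Y) w z z' -> repeatedly_coverable Y x y.
Proof.
  intros [u [t [Hu Hzt]]] Hyz Hw Hpos Hzw.
  (* By strong monotonicity [w] stays enabled above [z]; being positive, it can be run from there to
     a state that is again above [z]. Nothing is required of [z'] itself. *)
  assert (Hnext : forall s : {s | le Y z s}, exists s', le Y z s' /\
     steps (step Y) w (proj1_sig s) s').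
  { intros [s Hs]. simpl. destruct (steps_mono _ _ _ _ Hzw Hs) as [s1 [Hs1 _]].
    destruct (Hpos s) as [s' [Hs' Hle]]; [eauto|].
    exists s'. split; trivial. eapply le_trans; eauto. }
  set (nxt := fun s => let c := constructive_indefinite_description _ (Hnext s) in
    exist (fun s => le Y z s) (proj1_sig c) (proj1 (proj2_sig c))).
  set (sq := fix sq n := match n with
    | 0 => exist (fun s => le Y z s) t Hzt | S n' => nxt (sq n') end).
  exists (fun n => proj1_sig (sq n)). split; [|split].
  - exists u. trivial.
  - intros i. exists w. split; trivial. simpl.
    exact (proj2 (proj2_sig (constructive_indefinite_description _ (Hnext (sq i))))).
  - intros i. eapply le_trans; [trivial|exact Hyz|]. exact (proj2_sig (sq i)).
Qed.

(** The wqo provides [i < j] with [z i] below [z j]. The word read between them is positive for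
    [z i], hence positive because the system is. *)
Lemma repeatedly_coverable_loop x y :
  positive_ts Y -> repeatedly_coverable Y x y ->
  exists z z' w, coverable Y x z /\ le Y y z /\ w <> [] /\ positive_word Y w /\
    steps (step Y) w z z'.
Proof.
  intros Hpos [z [[u Hu] [Hz Hy]]].
  assert (Hreach : forall i, exists w, steps (step Y) w x (z i)).
  { induction i as [|i [w Hw]]; [eauto|]. destruct (Hz i) as [v [_ Hv]].
    exists (w ++ v). apply steps_app. eauto. }
  destruct Hwqo as [_ Hseq].
  destruct (Hseq z) as [i [j [Hij Hle]]]; [intros; exact Logic.I|].
  assert (Hw : exists w, w <> [] /\ steps (step Y) w (z i) (z j)).
  { clear Hle. induction Hij as [|j Hij IH]; trivial.
    destruct IH as [w [Hw1 Hw2]], (Hz j) as [v [_ Hv]].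
    exists (w ++ v). split; [now destruct w|]. apply steps_app. eauto. }
  destruct Hw as [w [Hw1 Hw2]], (Hreach i) as [v Hv].
  exists (z i), (z j), w. repeat split; trivial.
  - exists v, (z i). split; trivial. now apply le_refl.
  - apply Hpos. exists (z i), (z j). auto.
Qed.

(* A maximal member [K] of [F] is a maximal ideal of the coverability set, so a positive
   word [w] enabled at [K] satisfies [wpost Y w K = K]; by strict monotonicity the ideals
   met on the way are maximal as well, hence belong to [F]. *)
Lemma repeatedly_coverable_iff x y F :
  positive_ts Y -> (forall K, In K F -> derived Y x K) ->
  covers F (below Y x) -> post_closed Y F ->
  (repeatedly_coverable Y x y <->
   exists K, In K F /\ K y /\ exists w, w <> [] /\ positive_word Y w /\
     steps (fun a I J => In J F /\ cstep Y a I J) w K K).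
Proof.
  intros Hpos HF Hx Hc.
  assert (Hid : forall K, In K F -> is_ideal Y K) by (intros K HK; eapply derived_ideal; eauto).
  assert (Hcov : forall I, is_ideal Y I -> incl I (coverable Y x) -> covers F I)
    by (intros; eapply closed_cover_ideal; eauto).
  split.
  - intros Hrc.
    destruct (repeatedly_coverable_loop x y Hpos Hrc)
      as [z [z' [w [Hz [Hyz [Hw [Hwpos Hzz]]]]]]].
    destruct (closed_cover_coverable x F Hx Hc Hid z Hz) as [K0 [HK0 HK0z]].
    destruct (list_maximal incl F K0) as [K [HK [HKK Hmax]]]; unfold incl; auto.
    assert (HdK := ideal_down_closed _ _ (Hid K HK)).
    assert (HKx : incl K (coverable Y x)) by (eapply derived_coverable; eauto).
    (* Since [K] is directed, any [v] in [K] has an upper bound [t] in [K] that is also above [z].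
       There [w] is enabled, and positivity leads back above [t], hence above [v]. *)
    assert (HKw : incl K (wpost Y w K)).
    { intros v Hv. destruct (Hid K HK) as [_ [_ Hdir]].
      destruct (Hdir z v) as [t [Ht [Hzt Hvt]]]; auto.
      destruct (steps_mono _ _ _ _ Hzz Hzt) as [t' [Ht' _]].
      destruct (Hwpos t) as [t2 [Ht2 Htt]]; [eauto|].
      apply wpost_spec; trivial. exists t, t2. repeat split; trivial.
      eapply le_trans; eauto. }
    assert (Hin : forall u v I, is_ideal Y I -> incl I (coverable Y x) ->
        wpost Y v I = wpost Y w K -> w = u ++ v -> In I F).
    { intros u v I HI HIx HvI Huv.
      destruct (Hcov I HI HIx) as [L [HL HIL]].
      destruct (classic (incl L I)) as [HLI|HLI]; [now rewrite (set_ext I L)|].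
      exfalso.
      (* If [I] were strictly included in [L], the rest [v] of [w] would carry [L] strictly beyond
         [wpost Y w K], which contains the maximal [K], without leaving the coverability set. *)
      assert (Hne : exists t, wpost Y v I t)
        by (rewrite HvI; exists z; apply HKw; auto).
      destruct (wpost_strict v I L HI (Hid L HL) (conj HIL HLI) Hne) as [H1 H2].
      destruct (Hcov (wpost Y v L)) as [M [HM HLM]].
      - apply wpost_ideal; [auto|]. destruct Hne as [t Ht]. eauto.
      - apply wpost_coverable; [apply ideal_down_closed; auto|].
        eapply derived_coverable; eauto.
      - apply H2. rewrite HvI. intros t Ht. apply HKw.
        apply (Hmax M HM); [|auto]. intros s Hs. apply HLM, H1. rewrite HvI. auto. }
    assert (HwK : wpost Y w K = K).
    { destruct (Hcov (wpost Y w K)) as [L [HL HwL]].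
      - apply wpost_ideal; [auto|]. exists z. auto.
      - now apply wpost_coverable.
      - apply set_ext; trivial. intros t Ht. apply (Hmax L HL); [|auto].
        intros s Hs. auto. }
    exists K. split; trivial. split; [apply (HdK y z); auto|]. exists w.
    split; trivial. split; trivial.
    assert (Hrun : forall v u I, is_ideal Y I -> incl I (coverable Y x) ->
        wpost Y v I = wpost Y w K -> w = u ++ v ->
        steps (fun a I J => In J F /\ cstep Y a I J) v I K).
    { induction v as [|a v IH]; simpl; intros u I HI HIx HvI Huv; [congruence|].
      assert (Hne : exists t, downPost Y I a t).
      { apply (wpost_nonempty Y v). rewrite HvI. exists z. auto. }
      assert (HiI := downPost_ideal I a HI Hne).
      assert (HxI : incl (downPost Y I a) (coverable Y x)).
      { apply (wpost_coverable x [a]); trivial. now apply ideal_down_closed. }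
      assert (Euv : w = (u ++ [a]) ++ v) by (rewrite <- app_assoc; trivial).
      exists (downPost Y I a). split; [|eauto].
      split; [eauto|]. now apply downPost_cstep. }
    apply (Hrun w []); auto.
  - intros [K [HK [HKy [w [Hw [Hwpos Hst]]]]]].
    assert (HiK := Hid K HK).
    assert (HcK : steps (cstep Y) w K K).
    (* Only the common source of the two runs is generalized; their target stays [K]. *)
    { clear Hw Hwpos. revert Hst. generalize K at 1 3. induction w as [|a w IH]; simpl; auto.
      intros I [J [[_ HJ] H]]. eauto. }
    apply steps_cstep in HcK; trivial. destruct HcK as [_ [t Ht]].
    apply wpost_spec in Ht; [|now apply ideal_down_closed].
    destruct Ht as [i [i' [Hi [Hwi _]]]].
    (* The word is enabled at [i], perhaps not at [y]; directedness gives a state of [K] above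
       both. *)
    destruct HiK as [_ [_ Hdir]]. destruct (Hdir y i HKy Hi) as [z [Hz [Hyz Hiz]]].
    destruct (steps_mono _ _ _ _ Hwi Hiz) as [z' [Hz' _]].
    apply (steps_loop_repeatedly_coverable x y z z' w); trivial.
    eapply derived_coverable; eauto.
Qed.

End VeryWSTS.

(** * Closure properties of the computable partial functions *)

Notation "xs # i" := (nth i xs 0) (at level 9).

(* The domain [D] confines evaluation to valid codes: outside of them the given algorithms
   may diverge. *)
Definition comp (k : nat) (D : list nat -> Prop) (f : list nat -> nat) : Prop :=
  exists p, forall xs, length xs = k -> D xs -> eval p xs (f xs).

Definition compb (k : nat) (D : list nat -> Prop) (P : list nat -> bool) : Prop :=
  comp k D (fun xs => bool_nat (P xs)).

Definition prog1 (E : nat -> Prop) (h : nat -> nat) : Prop :=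
  exists p, forall a, E a -> eval p [a] (h a).
Definition prog2 (E : nat -> nat -> Prop) (h : nat -> nat -> nat) : Prop :=
  exists p, forall a b, E a b -> eval p [a; b] (h a b).
Definition prog3 (E : nat -> nat -> nat -> Prop) (h : nat -> nat -> nat -> nat) : Prop :=
  exists p, forall a b c, E a b c -> eval p [a; b; c] (h a b c).
Definition prog4 (E : nat -> nat -> nat -> nat -> Prop)
  (h : nat -> nat -> nat -> nat -> nat) : Prop :=
  exists p, forall a b c d, E a b c d -> eval p [a; b; c; d] (h a b c d).

Fixpoint bex (n : nat) (P : nat -> bool) : bool :=
  match n with 0 => false | S n' => P n' || bex n' P end.

Lemma bex_spec n P : bex n P = true <-> exists i, i < n /\ P i = true.
Proof.
  induction n as [|n IH]; simpl.
  - split; [easy|]. intros [i [Hi _]]. lia.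
  - rewrite orb_true_iff, IH. split.
    + intros [H|[i [Hi H]]]; [exists n; auto|exists i; auto].
    + intros [i [Hi H]]. destruct (Nat.eq_dec i n) as [->|Hn]; [auto|].
      right. exists i. split; [lia|trivial].
Qed.

Lemma comp_ext k D f g :
  (forall xs, length xs = k -> D xs -> f xs = g xs) -> comp k D f -> comp k D g.
Proof. intros H [p Hp]. exists p. intros xs Hk HD. rewrite <- H; auto. Qed.

Lemma comp_const k D n : comp k D (fun _ => n).
Proof.
  induction n as [|n [p Hp]].
  - exists PZero. intros. constructor.
  - exists (PComp PSucc [p]). intros xs Hk HD. econstructor.
    + repeat constructor. apply Hp; trivial.
    + apply (eSucc [n]).
Qed.

Lemma comp_var k D i : comp k D (fun xs => xs # i).
Proof. exists (PProj i). intros. constructor. Qed.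

Lemma comp_prog1 k D E h f :
  prog1 E h -> comp k D f -> (forall xs, length xs = k -> D xs -> E (f xs)) ->
  comp k D (fun xs => h (f xs)).
Proof.
  intros [p Hp] [q Hq] H. exists (PComp p [q]). intros xs Hk HD. econstructor.
  - repeat constructor; auto.
  - auto.
Qed.

Lemma comp_prog2 k D E h f g :
  prog2 E h -> comp k D f -> comp k D g ->
  (forall xs, length xs = k -> D xs -> E (f xs) (g xs)) ->
  comp k D (fun xs => h (f xs) (g xs)).
Proof.
  intros [p Hp] [q Hq] [r Hr] H. exists (PComp p [q; r]). intros xs Hk HD. econstructor.
  - repeat constructor; auto.
  - auto.
Qed.

Lemma comp_prog3 k D E h f g e :
  prog3 E h -> comp k D f -> comp k D g -> comp k D e ->
  (forall xs, length xs = k -> D xs -> E (f xs) (g xs) (e xs)) ->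
  comp k D (fun xs => h (f xs) (g xs) (e xs)).
Proof.
  intros [p Hp] [q Hq] [r Hr] [s Hs] H. exists (PComp p [q; r; s]).
  intros xs Hk HD. econstructor.
  - repeat constructor; auto.
  - auto.
Qed.

Lemma comp_prog4 k D E h f g e c :
  prog4 E h -> comp k D f -> comp k D g -> comp k D e -> comp k D c ->
  (forall xs, length xs = k -> D xs -> E (f xs) (g xs) (e xs) (c xs)) ->
  comp k D (fun xs => h (f xs) (g xs) (e xs) (c xs)).
Proof.
  intros [p Hp] [q Hq] [r Hr] [s Hs] [t Ht] H. exists (PComp p [q; r; s; t]).
  intros xs Hk HD. econstructor.
  - repeat constructor; auto.
  - auto.
Qed.

Lemma prog1_comp (E : nat -> Prop) D f :
  comp 1 D f -> (forall a, E a -> D [a]) -> prog1 E (fun a => f [a]).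
Proof. intros [p Hp] H. exists p. auto. Qed.

Lemma prog2_comp (E : nat -> nat -> Prop) D f :
  comp 2 D f -> (forall a b, E a b -> D [a; b]) -> prog2 E (fun a b => f [a; b]).
Proof. intros [p Hp] H. exists p. auto. Qed.

Lemma prog3_comp (E : nat -> nat -> nat -> Prop) D f :
  comp 3 D f -> (forall a b c, E a b c -> D [a; b; c]) ->
  prog3 E (fun a b c => f [a; b; c]).
Proof. intros [p Hp] H. exists p. auto. Qed.

Lemma prog4_comp (E : nat -> nat -> nat -> nat -> Prop) D f :
  comp 4 D f -> (forall a b c d, E a b c d -> D [a; b; c; d]) ->
  prog4 E (fun a b c d => f [a; b; c; d]).
Proof. intros [p Hp] H. exists p. auto. Qed.

(** Recursion and bounded search put a counter, and possibly an accumulator, in front of the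
    parameters; these projections recover the parameters. *)
Lemma evals_proj (pre xs : list nat) :
  evals (map PProj (seq (length pre) (length xs))) (pre ++ xs) xs.
Proof.
  revert pre. induction xs as [|x xs IH]; intros pre; simpl; constructor.
  - replace x with ((pre ++ x :: xs) # (length pre)) at 2 by apply nth_middle.
    constructor.
  - specialize (IH (pre ++ [x])). rewrite length_app, <- app_assoc in IH. simpl in IH.
    now rewrite Nat.add_1_r in IH.
Qed.

Lemma comp_tl k D f :
  comp k D f -> comp (S k) (fun ys => D (tl ys)) (fun ys => f (tl ys)).
Proof.
  intros [p Hp]. exists (PComp p (map PProj (seq 1 k))).
  intros [|y xs] Hk HD; [easy|]. injection Hk as Hk. simpl in *. econstructor; [|eauto].
  subst k. apply (evals_proj [y] xs).
Qed.

(** The function computed by [PRec], with its order of arguments: counter, accumulator,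
    parameters. *)
Definition loop (f : list nat -> nat) (G : list nat -> nat) (xs : list nat) (n : nat) : nat :=
  nat_rect (fun _ => nat) (f xs) (fun m r => G (m :: r :: xs)) n.

(** The body has to converge only on accumulators that really occur. An invariant, such as the
    accumulator being a valid code, can thus justify oracle calls in the body. *)
Lemma comp_loop k D D' b f G :
  comp k D b -> comp k D f -> comp (S (S k)) D' G ->
  (forall xs m, length xs = k -> D xs -> m < b xs -> D' (m :: loop f G xs m :: xs)) ->
  comp k D (fun xs => loop f G xs (b xs)).
Proof.
  intros [pb Hb] [pf Hf] [pG HG] H.
  exists (PComp (PRec pf pG) (pb :: map PProj (seq 0 k))). intros xs Hk HD.
  econstructor.
  - constructor; [apply Hb; trivial|]. subst k. apply (evals_proj [] xs).
  - assert (Hle : b xs <= b xs) by trivial. revert Hle.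
    (* The number of rounds becomes a variable bounded by [b xs], the bound up to which [H]
       applies. *)
    generalize (b xs) at 1 3 4. intros n.
    induction n as [|n IH]; intros Hn; simpl.
    + constructor. auto.
    + econstructor; [apply IH; lia|]. apply HG; [simpl; congruence|]. apply H; trivial.
Qed.

Lemma comp_if k D c f g :
  comp k D c -> comp k (fun xs => D xs /\ c xs <> 0) f -> comp k D g ->
  comp k D (fun xs => if c xs =? 0 then g xs else f xs).
Proof.
  intros Hc Hf Hg.
  apply (comp_ext _ _ (fun xs => loop g (fun ys => f (tl (tl ys))) xs (c xs))).
  - intros xs _ _. unfold loop. now destruct (c xs).
  - eapply comp_loop; trivial.
    + apply comp_tl with (f := fun xs => f (tl xs)), comp_tl, Hf.
    + simpl. intros xs m _ HD Hm. split; [trivial|lia].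
Qed.

Lemma compb_if k D c f g :
  compb k D c -> comp k (fun xs => D xs /\ c xs = true) f -> comp k D g ->
  comp k D (fun xs => if c xs then f xs else g xs).
Proof.
  intros Hc Hf Hg.
  apply (comp_ext _ _ (fun xs => if bool_nat (c xs) =? 0 then g xs else f xs)).
  - intros xs _ _. now destruct (c xs).
  - apply comp_if; trivial. destruct Hf as [p Hp]. exists p.
    intros xs Hk [HD H]. apply Hp; trivial. split; trivial. now destruct (c xs).
Qed.

Lemma compb_ext k D P Q :
  (forall xs, length xs = k -> D xs -> P xs = Q xs) -> compb k D P -> compb k D Q.
Proof. intros H. apply comp_ext. intros xs Hk HD. now rewrite H. Qed.

Lemma compb_zero k D f : comp k D f -> compb k D (fun xs => f xs =? 0).
Proof.
  intros H. apply (comp_ext _ _ (fun xs => if f xs =? 0 then 1 else 0)).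
  - intros xs _ _. now destruct (f xs).
  - apply comp_if with (f := fun _ => 0) (g := fun _ => 1); trivial; apply comp_const.
Qed.

Lemma compb_neg k D P : compb k D P -> compb k D (fun xs => negb (P xs)).
Proof.
  intros H. apply (compb_ext _ _ (fun xs => bool_nat (P xs) =? 0)).
  - intros xs _ _. now destruct (P xs).
  - now apply compb_zero.
Qed.

Lemma compb_and k D P Q :
  compb k D P -> compb k (fun xs => D xs /\ P xs = true) Q ->
  compb k D (fun xs => P xs && Q xs).
Proof.
  intros HP HQ. apply (comp_ext _ _ (fun xs => if P xs then bool_nat (Q xs) else 0)).
  - intros xs _ _. now destruct (P xs).
  - apply compb_if; trivial. apply comp_const.
Qed.

Lemma compb_bex k D D' b P :
  comp k D b -> compb (S k) D' P ->
  (forall xs m, length xs = k -> D xs -> m < b xs -> D' (m :: xs)) ->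
  compb k D (fun xs => bex (b xs) (fun m => P (m :: xs))).
Proof.
  intros Hb [p Hp] H.
  apply (comp_ext _ _ (fun xs => loop (fun _ => 0)
    (fun ys => if bool_nat (P (ys # 0 :: tl (tl ys))) =? 0 then ys # 1 else 1) xs (b xs))).
  - intros xs _ _. induction (b xs) as [|n IH]; [trivial|].
    simpl. rewrite IH. now destruct (P (n :: xs)).
  - apply (comp_loop k D (fun ys => D' (ys # 0 :: tl (tl ys)))); trivial.
    + apply comp_const.
    + apply comp_if with (f := fun _ => 1); [|apply comp_const|apply comp_var].
      (* [P] takes the counter and the parameters, so the accumulator at position 1 is skipped. *)
      exists (PComp p (PProj 0 :: map PProj (seq 2 k))).
      intros [|m [|r xs]] Hk HD; [easy|easy|]. injection Hk as Hk. simpl in *.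
      econstructor; [|apply Hp; [simpl; congruence|trivial]].
      constructor; [apply (eProj 0 (m :: r :: xs))|].
      subst k. apply (evals_proj [m; r] xs).
Qed.

(** * Arithmetic by primitive recursion *)

Definition always1 (_ : nat) : Prop := True.
Definition always2 (_ _ : nat) : Prop := True.

Lemma prog_succ : prog1 always1 S.
Proof. exists PSucc. intros a _. apply (eSucc [a]). Qed.

Lemma prog_pred : prog1 always1 pred.
Proof.
  apply (prog1_comp always1 (fun _ => True) (fun xs => pred (xs # 0))); [|easy].
  apply (comp_ext _ _ (fun xs => loop (fun _ => 0) (fun ys => ys # 0) xs (xs # 0))).
  - intros xs _ _. now destruct (xs # 0).
  - eapply (comp_loop 1 (fun _ => True) (fun _ => True)); trivial;
      auto using comp_const, comp_var.
Qed.

Lemma prog_add : prog2 always2 Nat.add.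
Proof.
  apply (prog2_comp always2 (fun _ => True) (fun xs => xs # 0 + xs # 1)); [|easy].
  apply (comp_ext _ _ (fun xs => loop (fun xs => xs # 1) (fun ys => S (ys # 1)) xs (xs # 0))).
  - intros xs _ _. induction (xs # 0) as [|n IH]; simpl; [trivial|]. now rewrite IH.
  - apply (comp_loop 2 (fun _ => True) (fun _ => True)); auto using comp_var.
    apply (comp_prog1 _ _ always1 S); auto using prog_succ, comp_var.
Qed.

Lemma prog_sub : prog2 always2 Nat.sub.
Proof.
  apply (prog2_comp always2 (fun _ => True) (fun xs => xs # 0 - xs # 1)); [|easy].
  apply (comp_ext _ _
    (fun xs => loop (fun xs => xs # 0) (fun ys => pred (ys # 1)) xs (xs # 1))).
  - intros xs _ _. induction (xs # 1) as [|n IH]; simpl; [lia|]. rewrite IH. lia.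
  - apply (comp_loop 2 (fun _ => True) (fun _ => True)); auto using comp_var.
    apply (comp_prog1 _ _ always1 pred); auto using prog_pred, comp_var.
Qed.

Lemma comp_succ k D f : comp k D f -> comp k D (fun xs => S (f xs)).
Proof. intros H. eapply comp_prog1; [apply prog_succ|trivial|easy]. Qed.

Lemma comp_pred k D f : comp k D f -> comp k D (fun xs => pred (f xs)).
Proof. intros H. eapply comp_prog1; [apply prog_pred|trivial|easy]. Qed.

Lemma comp_add k D f g : comp k D f -> comp k D g -> comp k D (fun xs => f xs + g xs).
Proof. intros Hf Hg. eapply comp_prog2; [apply prog_add|trivial|trivial|easy]. Qed.

Lemma comp_sub k D f g : comp k D f -> comp k D g -> comp k D (fun xs => f xs - g xs).
Proof. intros Hf Hg. eapply comp_prog2; [apply prog_sub|trivial|trivial|easy]. Qed.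

Lemma compb_leb k D f g :
  comp k D f -> comp k D g -> compb k D (fun xs => f xs <=? g xs).
Proof.
  intros Hf Hg. apply (compb_ext _ _ (fun xs => f xs - g xs =? 0)).
  - intros xs _ _. apply eq_true_iff_eq. rewrite Nat.eqb_eq, Nat.leb_le. lia.
  - auto using compb_zero, comp_sub.
Qed.

Lemma compb_ltb k D f g :
  comp k D f -> comp k D g -> compb k D (fun xs => f xs <? g xs).
Proof. intros Hf Hg. apply compb_leb; auto using comp_succ. Qed.

(** * Pairing and lists *)

Definition tri (n : nat) : nat := nat_rect (fun _ => nat) 0 (fun m r => S m + r) n.
(** The greatest [k] with [tri k <= n], that is, the diagonal of Cantor's pairing on which [n] lies.
    It grows by at most one from a number to the next, so one comparison per round suffices. *)
Definition diag (n : nat) : nat :=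
  nat_rect (fun _ => nat) 0 (fun m r => if S m <? tri (S r) then r else S r) n.
Definition psnd (n : nat) : nat := n - tri (diag n).
Definition pfst (n : nat) : nat := diag n - psnd n.

Lemma npair_tri x y : npair x y = tri (x + y) + y.
Proof.
  unfold npair. f_equal. induction (x + y) as [|n IH]; [trivial|].
  change (tri (S n)) with (S n + tri n). rewrite <- IH.
  replace (S n * (S n + 1)) with (n * (n + 1) + S n * 2) by lia.
  rewrite Nat.div_add by lia. lia.
Qed.

Lemma tri_le m n : m <= n -> tri m <= tri n.
Proof. induction 1; simpl; lia. Qed.

Lemma diag_spec n : tri (diag n) <= n < tri (S (diag n)).
Proof.
  induction n as [|n IH]; [simpl; lia|].
  change (diag (S n)) with (if S n <? tri (S (diag n)) then diag n else S (diag n)).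
  destruct (Nat.ltb_spec (S n) (tri (S (diag n)))) as [H|H]; [lia|].
  change (tri (S (S (diag n)))) with (S (S (diag n)) + tri (S (diag n))). lia.
Qed.

Lemma diag_npair x y : diag (npair x y) = x + y.
Proof.
  rewrite npair_tri. pose proof (diag_spec (tri (x + y) + y)) as H.
  set (d := diag (tri (x + y) + y)) in *. simpl in H.
  destruct (lt_eq_lt_dec d (x + y)) as [[Hd|Hd]|Hd]; trivial.
  - pose proof (tri_le (S d) (x + y) Hd) as Ht. simpl in Ht. lia.
  - pose proof (tri_le (S (x + y)) d Hd) as Ht. simpl in Ht. lia.
Qed.

Lemma psnd_npair x y : psnd (npair x y) = y.
Proof. unfold psnd. rewrite diag_npair, npair_tri. lia. Qed.

Lemma pfst_npair x y : pfst (npair x y) = x.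
Proof. unfold pfst. rewrite psnd_npair, diag_npair. lia. Qed.

Lemma npair_proj n : npair (pfst n) (psnd n) = n.
Proof.
  rewrite npair_tri. unfold pfst. pose proof (diag_spec n) as H. simpl in H.
  replace (diag n - psnd n + psnd n) with (diag n) by (unfold psnd; lia).
  unfold psnd. lia.
Qed.

Lemma npair_le x y x' y' : x <= x' -> y <= y' -> npair x y <= npair x' y'.
Proof.
  intros Hx Hy. rewrite !npair_tri.
  pose proof (tri_le (x + y) (x' + y')). lia.
Qed.

Lemma psnd_le n : psnd n <= n.
Proof. unfold psnd. lia. Qed.

Definition chead (c : nat) : nat := pfst (pred c).
(** Since [pred 0] and [psnd 0] are 0, dropping past the end yields 0, the code of the empty
    list. *)
Definition cdrop (k c : nat) : nat :=
  nat_rect (fun _ => nat) c (fun _ r => psnd (pred r)) k.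

Lemma cdrop_enc_list k l : cdrop k (enc_list l) = enc_list (skipn k l).
Proof.
  induction k as [|k IH]; [trivial|]. simpl. rewrite IH. clear IH.
  revert l. induction k as [|k IH]; intros [|x l]; try reflexivity.
  - simpl. apply psnd_npair.
  - apply (IH l).
Qed.

Lemma chead_enc_list x l : chead (enc_list (x :: l)) = x.
Proof. apply pfst_npair. Qed.

Lemma enc_list_length l : length l <= enc_list l.
Proof.
  induction l as [|x l IH]; simpl; [trivial|].
  pose proof (psnd_le (npair x (enc_list l))) as H. rewrite psnd_npair in H. lia.
Qed.

(** Every number codes a list, so an enumeration by numbers meets no malformed code. *)
Lemma enc_list_surj n : exists l, enc_list l = n.
Proof.
  induction n as [n IH] using lt_wf_ind. destruct n as [|n]; [exists []; trivial|].
  destruct (IH (psnd n)) as [l Hl]; [pose proof (psnd_le n); lia|].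
  exists (pfst n :: l). simpl. now rewrite Hl, npair_proj.
Qed.

Lemma npair_inj x y x' y' : npair x y = npair x' y' -> x = x' /\ y = y'.
Proof.
  intros H. split.
  - now rewrite <- (pfst_npair x y), H, pfst_npair.
  - now rewrite <- (psnd_npair x y), H, psnd_npair.
Qed.

Lemma enc_list_inj l l' : enc_list l = enc_list l' -> l = l'.
Proof.
  revert l'. induction l as [|x l IH]; intros [|x' l'] H; try easy.
  injection H as H. apply npair_inj in H. destruct H as [-> H]. f_equal. auto.
Qed.

(** Lets the answer of the positivity oracle be a function of the code of an automaton. *)
Lemma enc_aut_inj A B : enc_aut A = enc_aut B -> A = B.
Proof.
  destruct A as [i f l], B as [i' f' l']. intros H.
  apply npair_inj in H. destruct H as [Hi H]. apply npair_inj in H. destruct H as [Hf Hl].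
  apply enc_list_inj in Hi, Hf, Hl. simpl in *. subst. f_equal.
  revert l' Hl. induction l as [|[[q a] r] l IH]; intros [|[[q' a'] r'] l'] Hl; try easy.
  injection Hl as Ht Hl. apply npair_inj in Ht. destruct Ht as [-> Ht].
  apply npair_inj in Ht. destruct Ht as [-> ->]. f_equal. auto.
Qed.

Lemma prog_tri : prog1 always1 tri.
Proof.
  apply (prog1_comp always1 (fun _ => True) (fun xs => tri (xs # 0))); [|easy].
  apply (comp_loop 1 (fun _ => True) (fun _ => True) (fun xs => xs # 0) (fun _ => 0)
    (fun ys => S (ys # 0) + ys # 1));
    auto using comp_add, comp_succ, comp_const, comp_var.
Qed.

Lemma comp_tri k D f : comp k D f -> comp k D (fun xs => tri (f xs)).
Proof. intros H. eapply comp_prog1; [apply prog_tri|trivial|easy]. Qed.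

Lemma comp_npair k D f g :
  comp k D f -> comp k D g -> comp k D (fun xs => npair (f xs) (g xs)).
Proof.
  intros Hf Hg. apply (comp_ext _ _ (fun xs => tri (f xs + g xs) + g xs)).
  - intros. now rewrite npair_tri.
  - auto using comp_add, comp_tri.
Qed.

Lemma prog_diag : prog1 always1 diag.
Proof.
  apply (prog1_comp always1 (fun _ => True) (fun xs => diag (xs # 0))); [|easy].
  apply (comp_loop 1 (fun _ => True) (fun _ => True) (fun xs => xs # 0) (fun _ => 0)
    (fun ys => if S (ys # 0) <? tri (S (ys # 1)) then ys # 1 else S (ys # 1)));
    auto using comp_const, comp_var.
  apply compb_if with (f := fun ys => ys # 1) (c := fun ys => S (ys # 0) <? tri (S (ys # 1)))
    (g := fun ys => S (ys # 1));
    auto using compb_ltb, comp_tri, comp_succ, comp_var.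
Qed.

Lemma comp_diag k D f : comp k D f -> comp k D (fun xs => diag (f xs)).
Proof. intros H. eapply comp_prog1; [apply prog_diag|trivial|easy]. Qed.

Lemma comp_psnd k D f : comp k D f -> comp k D (fun xs => psnd (f xs)).
Proof. intros H. unfold psnd. auto using comp_sub, comp_tri, comp_diag. Qed.

Lemma comp_pfst k D f : comp k D f -> comp k D (fun xs => pfst (f xs)).
Proof. intros H. unfold pfst. auto using comp_sub, comp_psnd, comp_diag. Qed.

Lemma comp_chead k D f : comp k D f -> comp k D (fun xs => chead (f xs)).
Proof. intros H. unfold chead. auto using comp_pfst, comp_pred. Qed.

Lemma prog_cdrop : prog2 always2 cdrop.
Proof.
  apply (prog2_comp always2 (fun _ => True) (fun xs => cdrop (xs # 0) (xs # 1))); [|easy].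
  apply (comp_loop 2 (fun _ => True) (fun _ => True) (fun xs => xs # 0) (fun xs => xs # 1)
    (fun ys => psnd (pred (ys # 1))));
    auto using comp_psnd, comp_pred, comp_var.
Qed.

Lemma comp_cdrop k D f g :
  comp k D f -> comp k D g -> comp k D (fun xs => cdrop (f xs) (g xs)).
Proof. intros Hf Hg. eapply comp_prog2; [apply prog_cdrop|trivial|trivial|easy]. Qed.

(** [PMin] looks for a zero, hence the negated test. It also demands that all smaller arguments give
    successors, hence the least witness and not just any. *)
Lemma prog_least (E : nat -> nat -> Prop) (P : nat -> nat -> nat -> bool) :
  prog3 (fun _ a b => E a b) (fun n a b => bool_nat (P n a b)) ->
  (forall a b, E a b -> exists n, P n a b = true) ->
  exists h, prog2 E h /\ forall a b, E a b -> P (h a b) a b = true.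
Proof.
  intros HP Hex.
  assert (Hneg : comp 3 (fun xs => E (xs # 1) (xs # 2))
     (fun xs => bool_nat (negb (P (xs # 0) (xs # 1) (xs # 2))))).
  { apply compb_neg. unfold compb.
    apply (comp_prog3 _ _ _ (fun n a b => bool_nat (P n a b)) _ _ _ HP); auto using comp_var. }
  destruct Hneg as [p Hp].
  set (least := fun a b n => P n a b = true /\ forall m, m < n -> P m a b = false).
  assert (Hleast : forall a b, exists n, E a b -> least a b n).
  { intros a b. destruct (classic (E a b)) as [HE|HE]; [|exists 0; easy].
    destruct (Hex a b HE) as [n Hn].
    induction n as [n IH] using lt_wf_ind.
    destruct (classic (exists m, m < n /\ P m a b = true)) as [[m [Hm HPm]]|Hno]; eauto.
    exists n. split; trivial. intros m Hm. destruct (P m a b) eqn:HPm; trivial.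
    exfalso. eauto. }
  exists (fun a b => proj1_sig (constructive_indefinite_description _ (Hleast a b))).
  split.
  - exists (PMin p). intros a b HE.
    destruct (constructive_indefinite_description _ (Hleast a b)) as [n Hn]. simpl.
    destruct (Hn HE) as [H1 H2]. constructor.
    + specialize (Hp [n; a; b] eq_refl HE). simpl in Hp. now rewrite H1 in Hp.
    + intros m Hm. exists 0. specialize (Hp [m; a; b] eq_refl HE). simpl in Hp.
      now rewrite (H2 m Hm) in Hp.
  - intros a b HE.
    destruct (constructive_indefinite_description _ (Hleast a b)) as [n Hn]. simpl.
    now apply Hn.
Qed.

(** * The decision procedure *)

Section Decision.

Variable C : ts_class.
Variables osucc oinf : nat -> nat -> nat -> nat.
Variable oincl : nat -> nat -> nat -> bool.
Variable odown : nat -> nat -> nat.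
Variable opos : nat -> nat -> bool.

Definition idl (d c : nat) : St (sys C d) -> Prop :=
  match idl_of C d c with Some J => J | None => fun _ => False end.

Definition is_code (d c : nat) : Prop := inC C d /\ exists I, idl_of C d c = Some I.

Definition is_state (d cx : nat) : Prop := inC C d /\ exists x, st_of C d cx = Some x.

Definition is_word (d cw : nat) : Prop :=
  exists w, enc_list w = cw /\ forall a, In a w -> a < nsig (sys C d).

Hypothesis Hclass : forall d, inC C d -> positive_ts (sys C d) /\ very_wsts (sys C d).

Hypothesis nsig_prog : prog1 (inC C) (fun d => nsig (sys C d)).
Hypothesis odown_prog : prog2 is_state odown.
Hypothesis odown_spec : forall d cx x, inC C d -> st_of C d cx = Some x ->
  is_code d (odown d cx) /\ idl d (odown d cx) = below (sys C d) x.
Hypothesis oincl_prog : prog3 (fun d c c' => is_code d c /\ is_code d c')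
  (fun d c c' => bool_nat (oincl d c c')).
Hypothesis oincl_spec : forall d c c', is_code d c -> is_code d c' ->
  (oincl d c c' = true <-> incl (idl d c) (idl d c')).
Hypothesis osucc_prog : prog3 (fun d c a => is_code d c /\ a < nsig (sys C d)) osucc.
Hypothesis osucc_spec : forall d c a, is_code d c -> a < nsig (sys C d) ->
  (osucc d c a = 0 /\ ~ exists J, cstep (sys C d) a (idl d c) J) \/
  (exists c', osucc d c a = S c' /\ is_code d c' /\ cstep (sys C d) a (idl d c) (idl d c')).
Hypothesis oinf_prog : prog3 (fun d c cw => is_code d c /\ is_word d cw) oinf.
Hypothesis oinf_spec : forall d c w, is_code d c -> is_word d (enc_list w) ->
  is_code d (oinf d c (enc_list w)) /\
  winf (sys C d) w (idl d c) (idl d (oinf d c (enc_list w))).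
Hypothesis opos_prog : prog2
  (fun d cA => inC C d /\ exists A, over_alphabet (nsig (sys C d)) A /\ enc_aut A = cA)
  (fun d cA => bool_nat (opos d cA)).
Hypothesis opos_spec : forall d A, inC C d -> over_alphabet (nsig (sys C d)) A ->
  (opos d (enc_aut A) = true <-> exists w, in_lang A w /\ positive_word (sys C d) w).

Lemma comp_nsig k D f :
  comp k D f -> (forall xs, length xs = k -> D xs -> inC C (f xs)) ->
  comp k D (fun xs => nsig (sys C (f xs))).
Proof. intros Hf H. now apply (comp_prog1 k D _ (fun d => nsig (sys C d)) f nsig_prog). Qed.

(** The acceleration oracle may diverge on words that leave the alphabet, hence this test. A code is
    at least the length of its list, so the bound [cw] reaches every position, and those past the
    end are passed over. *)
Definition wordb (d cw : nat) : bool :=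
  negb (bex cw (fun i => negb (cdrop i cw =? 0) &&
                         negb (chead (cdrop i cw) <? nsig (sys C d)))).

Lemma wordb_spec d cw : wordb d cw = true <-> is_word d cw.
Proof.
  unfold wordb. rewrite negb_true_iff, <- not_true_iff_false, bex_spec.
  destruct (enc_list_surj cw) as [w <-]. split.
  - intros H. exists w. split; trivial. intros a Ha.
    apply in_split in Ha. destruct Ha as [u [v ->]].
    apply NNPP. intros Hn. apply H. exists (length u).
    pose proof (enc_list_length (u ++ a :: v)) as Hl.
    rewrite length_app in Hl. simpl in Hl. split; [lia|].
    rewrite cdrop_enc_list, skipn_app, skipn_all, Nat.sub_diag. cbn [skipn app].
    rewrite chead_enc_list. apply andb_true_iff. split; [reflexivity|].
    rewrite negb_true_iff. apply Nat.ltb_ge. lia.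
  - intros [w' [Hw' H]] [i [_ Hi]]. rewrite <- Hw' in Hi.
    rewrite cdrop_enc_list in Hi. destruct (skipn i w') as [|a v] eqn:E; [easy|].
    rewrite chead_enc_list in Hi. apply andb_true_iff in Hi. destruct Hi as [_ Hi].
    rewrite negb_true_iff, Nat.ltb_ge in Hi.
    assert (Ha : In a w').
    { rewrite <- (firstn_skipn i w'), E. apply in_or_app. right. now left. }
    specialize (H a Ha). lia.
Qed.

Lemma wordb_prog : prog2 (fun d _ => inC C d) (fun d cw => bool_nat (wordb d cw)).
Proof.
  apply (prog2_comp _ (fun xs => inC C (xs # 0))
    (fun xs => bool_nat (wordb (xs # 0) (xs # 1)))); [|trivial].
  apply compb_neg.
  apply (compb_bex 2 _ (fun ys => inC C (ys # 1)) (fun xs => xs # 1)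
    (fun ys => negb (cdrop (ys # 0) (ys # 2) =? 0) &&
               negb (chead (cdrop (ys # 0) (ys # 2)) <? nsig (sys C (ys # 1)))));
    [apply comp_var| |trivial].
  apply compb_and.
  - auto using compb_neg, compb_zero, comp_cdrop, comp_var.
  - apply compb_neg, compb_ltb.
    + auto using comp_chead, comp_cdrop, comp_var.
    + apply comp_nsig; [apply comp_var|]. intros xs _ H. apply H.
Qed.

(* The instruction [npair 0 a] asks for the successor under the letter [a], and
   [npair (S _) (enc_list w)] for the acceleration of [w]. *)
Definition exec (d c e : nat) : nat :=
  if pfst e =? 0
  then if psnd e <? nsig (sys C d)
       then if osucc d c (psnd e) =? 0 then c else pred (osucc d c (psnd e))
       else c
  else if wordb d (psnd e) then oinf d c (psnd e) else c.

(** Illegal or disabled instructions leave the code unchanged, so every list of instructions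
    produces a valid code. *)
Lemma exec_code d c e : is_code d c -> is_code d (exec d c e).
Proof.
  intros Hc. unfold exec. destruct (pfst e =? 0).
  - destruct (Nat.ltb_spec (psnd e) (nsig (sys C d))) as [Ha|Ha]; trivial.
    destruct (osucc_spec d c (psnd e) Hc Ha) as [[-> _]|[c' [-> [Hc' _]]]]; trivial.
  - destruct (wordb d (psnd e)) eqn:E; trivial. apply wordb_spec in E.
    destruct (enc_list_surj (psnd e)) as [w Hw]. rewrite <- Hw in *.
    now apply oinf_spec.
Qed.

Lemma exec_derived d x c e :
  is_code d c -> derived (sys C d) x (idl d c) -> derived (sys C d) x (idl d (exec d c e)).
Proof.
  intros Hc HI. unfold exec. destruct (pfst e =? 0).
  - destruct (Nat.ltb_spec (psnd e) (nsig (sys C d))) as [Ha|Ha]; trivial.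
    destruct (osucc_spec d c (psnd e) Hc Ha) as [[-> _]|[c' [-> [Hc' HJ]]]]; trivial.
    eapply derived_step; eauto.
  - destruct (wordb d (psnd e)) eqn:E; trivial. apply wordb_spec in E.
    destruct E as [w [Hw Ha]]. rewrite <- Hw in *.
    eapply derived_winf; [exact Ha|exact HI|]. apply oinf_spec; trivial. now exists w.
Qed.

Lemma exec_prog : prog3 (fun d c _ => is_code d c) exec.
Proof.
  apply (prog3_comp _ (fun xs => is_code (xs # 0) (xs # 1))
    (fun xs => exec (xs # 0) (xs # 1) (xs # 2))); [|trivial].
  apply (comp_if 3 _ (fun xs => pfst (xs # 2))
    (fun xs => if wordb (xs # 0) (psnd (xs # 2))
               then oinf (xs # 0) (xs # 1) (psnd (xs # 2)) else xs # 1)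
    (fun xs => if psnd (xs # 2) <? nsig (sys C (xs # 0))
               then if osucc (xs # 0) (xs # 1) (psnd (xs # 2)) =? 0 then xs # 1
                    else pred (osucc (xs # 0) (xs # 1) (psnd (xs # 2)))
               else xs # 1)).
  - auto using comp_pfst, comp_var.
  - apply (compb_if 3 _ (fun xs => wordb (xs # 0) (psnd (xs # 2)))
      (fun xs => oinf (xs # 0) (xs # 1) (psnd (xs # 2)))); [| |apply comp_var].
    + apply (comp_prog2 _ _ _ (fun d cw => bool_nat (wordb d cw)) _ _ wordb_prog);
        auto using comp_psnd, comp_var. intros xs _ [[H _] _]. trivial.
    + apply (comp_prog3 _ _ _ oinf _ _ _ oinf_prog); auto using comp_psnd, comp_var.
      intros xs _ [[H _] Hw]. split; trivial. now apply wordb_spec.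
  - assert (Hs : comp 3 (fun xs => is_code (xs # 0) (xs # 1) /\
        (psnd (xs # 2) <? nsig (sys C (xs # 0))) = true)
        (fun xs => osucc (xs # 0) (xs # 1) (psnd (xs # 2)))).
    { apply (comp_prog3 _ _ _ osucc _ _ _ osucc_prog); auto using comp_psnd, comp_var.
      intros xs _ [H Hw]. split; trivial. now apply Nat.ltb_lt. }
    apply (compb_if 3 _ (fun xs => psnd (xs # 2) <? nsig (sys C (xs # 0)))
      (fun xs => if osucc (xs # 0) (xs # 1) (psnd (xs # 2)) =? 0 then xs # 1
                 else pred (osucc (xs # 0) (xs # 1) (psnd (xs # 2)))));
      [| |apply comp_var].
    + apply compb_ltb; [auto using comp_psnd, comp_var|].
      apply comp_nsig; [apply comp_var|]. intros xs _ [H _]. trivial.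
    + apply (comp_if 3 _ (fun xs => osucc (xs # 0) (xs # 1) (psnd (xs # 2)))
        (fun xs => pred (osucc (xs # 0) (xs # 1) (psnd (xs # 2)))) (fun xs => xs # 1));
        [exact Hs| |apply comp_var].
      destruct (comp_pred _ _ _ Hs) as [p Hp]. exists p. intros xs Hk [HD _]. auto.
Qed.

(* Executes the list of instructions coded by [m]. The iteration count [m] is at least the
   length of that list, and [cdrop k m] is 0 past its end. *)
Definition ideal_code (d cx m : nat) : nat :=
  nat_rect (fun _ => nat) (odown d cx)
    (fun k c => if cdrop k m =? 0 then c else exec d c (chead (cdrop k m))) m.

Lemma ideal_code_is_code d cx m : is_state d cx -> is_code d (ideal_code d cx m).
Proof.
  intros [Hd [x Hx]]. unfold ideal_code. generalize m at 3. intros n.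
  induction n as [|n IH]; simpl.
  - now apply (odown_spec d cx x).
  - destruct (cdrop n m =? 0); auto using exec_code.
Qed.

Lemma ideal_code_derived d cx x m :
  inC C d -> st_of C d cx = Some x -> derived (sys C d) x (idl d (ideal_code d cx m)).
Proof.
  intros Hd Hx. unfold ideal_code. generalize m at 3. intros n.
  enough (H : forall c, c = nat_rect (fun _ => nat) (odown d cx)
    (fun k c => if cdrop k m =? 0 then c else exec d c (chead (cdrop k m))) n ->
    is_code d c /\ derived (sys C d) x (idl d c)) by now apply H.
  induction n as [|n IH]; simpl; intros c ->.
  - destruct (odown_spec d cx x Hd Hx) as [Hc ->]. split; [trivial|constructor].
  - destruct (IH _ eq_refl) as [Hc HI].
    destruct (cdrop n m =? 0); auto using exec_code, exec_derived.
Qed.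

Lemma ideal_code_prog : prog3 (fun d cx _ => is_state d cx) ideal_code.
Proof.
  apply (prog3_comp _ (fun xs => is_state (xs # 0) (xs # 1))
    (fun xs => ideal_code (xs # 0) (xs # 1) (xs # 2))); [|trivial].
  apply (comp_loop 3 _ (fun ys => is_code (ys # 2) (ys # 1)) (fun xs => xs # 2)
    (fun xs => odown (xs # 0) (xs # 1))
    (fun ys => if cdrop (ys # 0) (ys # 4) =? 0 then ys # 1
               else exec (ys # 2) (ys # 1) (chead (cdrop (ys # 0) (ys # 4))))).
  - apply comp_var.
  - apply (comp_prog2 _ _ _ odown _ _ odown_prog); auto using comp_var.
  - apply (comp_if 5 _ (fun ys => cdrop (ys # 0) (ys # 4))
      (fun ys => exec (ys # 2) (ys # 1) (chead (cdrop (ys # 0) (ys # 4))))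
      (fun ys => ys # 1)).
    + auto using comp_cdrop, comp_var.
    + apply (comp_prog3 _ _ _ exec _ _ _ exec_prog);
        auto using comp_chead, comp_cdrop, comp_var. now intros xs _ [H _].
    + apply comp_var.
  - intros xs m Hk [Hd [x Hx]] _. simpl. induction m as [|m IH].
    + now apply (odown_spec _ _ x).
    + unfold loop in *. simpl. destruct (cdrop m (xs # 2) =? 0); auto using exec_code.
Qed.

Lemma comp_ideal_code k D f g h :
  comp k D f -> comp k D g -> comp k D h ->
  (forall xs, length xs = k -> D xs -> is_state (f xs) (g xs)) ->
  comp k D (fun xs => ideal_code (f xs) (g xs) (h xs)).
Proof. intros. now apply (comp_prog3 _ _ _ ideal_code _ _ _ ideal_code_prog). Qed.

Lemma firstn_succ {T : Type} (k : nat) (l : list T) :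
  firstn (S k) l = firstn k l ++ match skipn k l with [] => [] | a :: _ => [a] end.
Proof.
  revert l. induction k as [|k IH]; intros [|a l]; trivial.
  simpl. f_equal. apply IH.
Qed.

Lemma ideal_code_enc_list d cx l :
  ideal_code d cx (enc_list l) = fold_left (exec d) l (odown d cx).
Proof.
  unfold ideal_code.
  assert (H : forall k, nat_rect (fun _ => nat) (odown d cx)
    (fun k c => if cdrop k (enc_list l) =? 0 then c
                else exec d c (chead (cdrop k (enc_list l)))) k
    = fold_left (exec d) (firstn k l) (odown d cx)).
  { induction k as [|k IH]; [trivial|]. rewrite firstn_succ, fold_left_app, <- IH.
    simpl. rewrite cdrop_enc_list. destruct (skipn k l) as [|a t]; [trivial|].
    now rewrite chead_enc_list. }
  rewrite H, firstn_all2; [trivial|]. apply enc_list_length.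
Qed.

(** Each rule of [derived] appends one instruction. The oracles may return other codes than those of
    a given derivation, but successors and accelerations are unique as sets. *)
Lemma derived_ideal_code d cx x I :
  inC C d -> st_of C d cx = Some x -> derived (sys C d) x I ->
  exists m, idl d (ideal_code d cx m) = I.
Proof.
  intros Hd Hx HI. destruct (Hclass d Hd) as [_ Hv].
  cut (exists l, idl d (fold_left (exec d) l (odown d cx)) = I).
  { intros [l Hl]. exists (enc_list l). now rewrite ideal_code_enc_list. }
  assert (Hcode : forall l, is_code d (fold_left (exec d) l (odown d cx))).
  { intros l. rewrite <- ideal_code_enc_list. apply ideal_code_is_code.
    split; [trivial|eauto]. }
  induction HI as [|a I J HI [l Hl] HJ|w I J Hw HI [l Hl] HJ].
  - exists []. now apply odown_spec.
  - exists (l ++ [npair 0 a]). rewrite fold_left_app. simpl. unfold exec at 1.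
    rewrite pfst_npair, psnd_npair. simpl.
    assert (Ha : a < nsig (sys C d)).
    { destruct HJ as [[[z Hz] _] [HJ _]].
      destruct (HJ z Hz) as [i [y [_ [[Ha _] _]]]]. trivial. }
    rewrite (proj2 (Nat.ltb_lt _ _) Ha).
    destruct (osucc_spec d _ a (Hcode l) Ha) as [[_ Hno]|[c' [-> [_ HJ']]]].
    + exfalso. apply Hno. rewrite Hl. eauto.
    + simpl. rewrite Hl in HJ'. assert (HiI := derived_ideal _ Hv _ _ HI).
      rewrite (cstep_downPost _ Hv _ _ _ HiI HJ), (cstep_downPost _ Hv _ _ _ HiI HJ').
      trivial.
  - exists (l ++ [npair 1 (enc_list w)]). rewrite fold_left_app. simpl. unfold exec at 1.
    rewrite pfst_npair, psnd_npair. simpl.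
    assert (Hcw : is_word d (enc_list w)) by now exists w.
    rewrite (proj2 (wordb_spec d _) Hcw).
    destruct (oinf_spec d _ w (Hcode l) Hcw) as [_ HJ']. rewrite Hl in HJ'.
    eapply winf_unique; eauto.
Qed.

(** * The search for a closed cover *)

Definition coveredb (d cx n c : nat) : bool :=
  bex n (fun j => oincl d c (ideal_code d cx j)).

(** The test [n <> 0] puts the root into the family, as 0 codes the empty list of instructions. The
    argument [n] comes first because it is the one minimized. *)
Definition closedb (n d cx : nat) : bool :=
  negb (n =? 0) && negb (bex n (fun i => bex (nsig (sys C d)) (fun a =>
    negb (osucc d (ideal_code d cx i) a =? 0) &&
    negb (coveredb d cx n (pred (osucc d (ideal_code d cx i) a)))))).

Definition ideals (d cx n : nat) : list (St (sys C d) -> Prop) :=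
  map (fun i => idl d (ideal_code d cx i)) (seq 0 n).

Lemma in_ideals d cx n I :
  In I (ideals d cx n) <-> exists i, i < n /\ idl d (ideal_code d cx i) = I.
Proof.
  unfold ideals. rewrite in_map_iff. split; intros [i [H1 H2]]; exists i.
  - apply in_seq in H2. split; [lia|trivial].
  - split; trivial. apply in_seq. lia.
Qed.

Lemma coveredb_spec d cx n c :
  is_state d cx -> is_code d c ->
  (coveredb d cx n c = true <-> covers (ideals d cx n) (idl d c)).
Proof.
  intros Hx Hc. unfold coveredb. rewrite bex_spec. split.
  - intros [j [Hj H]]. apply oincl_spec in H; auto using ideal_code_is_code.
    exists (idl d (ideal_code d cx j)). split; trivial. apply in_ideals. eauto.
  - intros [L [HL H]]. apply in_ideals in HL. destruct HL as [j [Hj <-]].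
    exists j. split; trivial. apply oincl_spec; auto using ideal_code_is_code.
Qed.

Lemma coveredb_prog : prog4 (fun d cx _ c => is_state d cx /\ is_code d c)
  (fun d cx n c => bool_nat (coveredb d cx n c)).
Proof.
  apply (prog4_comp _ (fun xs => is_state (xs # 0) (xs # 1) /\ is_code (xs # 0) (xs # 3))
    (fun xs => bool_nat (coveredb (xs # 0) (xs # 1) (xs # 2) (xs # 3)))); [|trivial].
  apply (compb_bex 4 _ (fun ys => is_state (ys # 1) (ys # 2) /\ is_code (ys # 1) (ys # 4))
    (fun xs => xs # 2)
    (fun ys => oincl (ys # 1) (ys # 4) (ideal_code (ys # 1) (ys # 2) (ys # 0))));
    [apply comp_var| |trivial].
  apply (comp_prog3 _ _ _ (fun d c c' => bool_nat (oincl d c c')) _ _ _ oincl_prog);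
    try apply comp_ideal_code; auto using comp_var.
  - now intros xs _ [H _].
  - intros xs _ [H Hc]. auto using ideal_code_is_code.
Qed.

Lemma closedb_prog : prog3 (fun _ d cx => is_state d cx)
  (fun n d cx => bool_nat (closedb n d cx)).
Proof.
  apply (prog3_comp _ (fun xs => is_state (xs # 1) (xs # 2))
    (fun xs => bool_nat (closedb (xs # 0) (xs # 1) (xs # 2)))); [|trivial].
  apply compb_and; [auto using compb_neg, compb_zero, comp_var|].
  apply compb_neg.
  apply (compb_bex 3 _ (fun ys => is_state (ys # 2) (ys # 3)) (fun xs => xs # 0)
    (fun ys => bex (nsig (sys C (ys # 2))) (fun a =>
      negb (osucc (ys # 2) (ideal_code (ys # 2) (ys # 3) (ys # 0)) a =? 0) &&
      negb (coveredb (ys # 2) (ys # 3) (ys # 1)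
        (pred (osucc (ys # 2) (ideal_code (ys # 2) (ys # 3) (ys # 0)) a))))));
    [apply comp_var| |now intros xs m _ [H _] _].
  apply (compb_bex 4 _
    (fun ys => is_state (ys # 3) (ys # 4) /\ ys # 0 < nsig (sys C (ys # 3)))
    (fun ys => nsig (sys C (ys # 2)))
    (fun ys =>
      negb (osucc (ys # 3) (ideal_code (ys # 3) (ys # 4) (ys # 1)) (ys # 0) =? 0) &&
      negb (coveredb (ys # 3) (ys # 4) (ys # 2)
        (pred (osucc (ys # 3) (ideal_code (ys # 3) (ys # 4) (ys # 1)) (ys # 0))))));
    [|  |now intros xs m _ H Hm].
  { apply comp_nsig; [apply comp_var|]. now intros xs _ [H _]. }
  assert (Hs : comp 5
    (fun ys => is_state (ys # 3) (ys # 4) /\ ys # 0 < nsig (sys C (ys # 3)))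
    (fun ys => osucc (ys # 3) (ideal_code (ys # 3) (ys # 4) (ys # 1)) (ys # 0))).
  { apply (comp_prog3 _ _ _ osucc _ _ _ osucc_prog);
      try apply comp_ideal_code; auto using comp_var.
    - now intros xs _ [H _].
    - intros xs _ [H Ha]. auto using ideal_code_is_code. }
  apply compb_and; [auto using compb_neg, compb_zero|]. apply compb_neg.
  apply (comp_prog4 _ _ _ (fun d cx n c => bool_nat (coveredb d cx n c)) _ _ _ _
    coveredb_prog); auto using comp_var.
  - apply comp_pred. destruct Hs as [p Hp]. exists p. intros xs Hk [H _]. auto.
  - intros xs _ [[Hx Ha] Hne]. split; trivial.
    destruct (osucc_spec (xs # 3) (ideal_code (xs # 3) (xs # 4) (xs # 1)) (xs # 0))
      as [[E _]|[c [E [Hc _]]]]; auto using ideal_code_is_code.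
    + rewrite E in Hne. easy.
    + now rewrite E.
Qed.

Lemma closedb_sound d cx x n :
  inC C d -> st_of C d cx = Some x -> closedb n d cx = true ->
  covers (ideals d cx n) (below (sys C d) x) /\ post_closed (sys C d) (ideals d cx n).
Proof.
  intros Hd Hx H. destruct (Hclass d Hd) as [_ Hv].
  assert (Hst : is_state d cx) by (split; eauto).
  apply andb_true_iff in H. destruct H as [Hn H].
  rewrite negb_true_iff, Nat.eqb_neq in Hn.
  rewrite negb_true_iff, <- not_true_iff_false, bex_spec in H. split.
  - exists (below (sys C d) x). split; [|intros z Hz; trivial].
    apply in_ideals. exists 0. split; [lia|]. now apply odown_spec.
  - intros K a HK Hne. apply in_ideals in HK. destruct HK as [i [Hi <-]].
    assert (Ha : a < nsig (sys C d)).
    { destruct Hne as [z [j [y [_ [[Ha _] _]]]]]. trivial. }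
    assert (Hc := ideal_code_is_code d cx i Hst).
    assert (HiI := derived_ideal _ Hv _ _ (ideal_code_derived d cx x i Hd Hx)).
    destruct (osucc_spec d _ a Hc Ha) as [[E Hno]|[c [E [Hc' HJ]]]].
    + exfalso. apply Hno. eexists. apply downPost_cstep; trivial.
    + rewrite <- (cstep_downPost _ Hv _ _ _ HiI HJ).
      apply coveredb_spec; trivial.
      apply not_false_iff_true. intros Hcov. apply H. exists i. split; trivial.
      apply bex_spec. exists a. split; trivial. rewrite E. simpl. now rewrite Hcov.
Qed.

(** An initial segment of the enumeration contains a closed cover [F] along with unrelated derived
    ideals. These do no harm: their successors are included in the coverability set, so [F] covers
    them too. *)
Lemma closedb_exists d cx : is_state d cx -> exists n, closedb n d cx = true.
Proof.
  intros [Hd [x Hx]]. destruct (Hclass d Hd) as [_ Hv].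
  assert (Hst : is_state d cx) by (split; eauto).
  destruct (closed_cover_exists _ Hv x) as [F [HF [HFx HFc]]].
  assert (Hn : exists n, forall K, In K F -> In K (ideals d cx n)).
  { clear HFx HFc. induction F as [|K F IH]; [exists 0; easy|].
    destruct IH as [n Hn]; [intros; apply HF; now right|].
    destruct (derived_ideal_code d cx x K Hd Hx) as [m Hm]; [apply HF; now left|].
    exists (n + S m). intros L HL. apply in_ideals. destruct HL as [<-|HL].
    - exists m. split; [lia|trivial].
    - apply Hn, in_ideals in HL. destruct HL as [i [Hi HL]].
      exists i. split; [lia|trivial]. }
  destruct Hn as [n Hn]. exists n. unfold closedb. apply andb_true_iff. split.
  - rewrite negb_true_iff, Nat.eqb_neq. intros ->.
    destruct HFx as [L [HL _]]. exact (Hn L HL).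
  - rewrite negb_true_iff, <- not_true_iff_false, bex_spec.
    intros [i [Hi H]]. apply bex_spec in H. destruct H as [a [Ha H]].
    apply andb_true_iff in H. destruct H as [H1 H2].
    assert (Hdi := ideal_code_derived d cx x i Hd Hx).
    destruct (osucc_spec d _ a (ideal_code_is_code d cx i Hst) Ha)
      as [[E _]|[c [E [Hc HJ]]]]; [now rewrite E in H1|].
    rewrite E in H2. simpl in H2.
    rewrite negb_true_iff, <- not_true_iff_false in H2. apply H2.
    apply coveredb_spec; trivial.
    assert (HdJ := derived_step _ _ _ _ _ Hdi HJ).
    apply (covers_sub F); trivial. apply (closed_cover_ideal _ Hv x); trivial.
    + intros K HK. eapply derived_ideal; eauto.
    + eapply derived_ideal; eauto.
    + eapply derived_coverable; eauto.
Qed.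

(** * The automaton of exact loops *)

Definition edgeb (d c a c' : nat) : bool :=
  negb (osucc d c a =? 0) &&
  (oincl d (pred (osucc d c a)) c' && oincl d c' (pred (osucc d c a))).

(** One ideal may have several codes, so the computed successor is compared with [c'] by inclusion
    in both directions. *)
Lemma edgeb_spec d c a c' :
  is_code d c -> is_code d c' -> a < nsig (sys C d) -> is_ideal (sys C d) (idl d c) ->
  (edgeb d c a c' = true <-> cstep (sys C d) a (idl d c) (idl d c')).
Proof.
  intros Hc Hc' Ha HI. destruct (Hclass d (proj1 Hc)) as [_ Hv]. unfold edgeb.
  destruct (osucc_spec d c a Hc Ha) as [[E Hno]|[s [E [Hs HJ]]]]; rewrite E; simpl.
  - split; [easy|]. intros H. exfalso. eauto.
  - rewrite andb_true_iff, !oincl_spec by trivial. split.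
    + intros [H1 H2]. now rewrite (set_ext (idl d c') (idl d s)).
    + intros H. rewrite (cstep_downPost _ Hv _ _ _ HI HJ), (cstep_downPost _ Hv _ _ _ HI H).
      split; intros z; trivial.
Qed.

Lemma edgeb_prog :
  prog4 (fun d c a c' => is_code d c /\ a < nsig (sys C d) /\ is_code d c')
    (fun d c a c' => bool_nat (edgeb d c a c')).
Proof.
  set (D := fun xs => is_code (xs # 0) (xs # 1) /\ xs # 2 < nsig (sys C (xs # 0)) /\
    is_code (xs # 0) (xs # 3)).
  apply (prog4_comp _ D
    (fun xs => bool_nat (edgeb (xs # 0) (xs # 1) (xs # 2) (xs # 3)))); [|trivial].
  assert (Hs : comp 4 D (fun xs => osucc (xs # 0) (xs # 1) (xs # 2))).
  { apply (comp_prog3 _ _ _ osucc _ _ _ osucc_prog); auto using comp_var.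
    intros xs _ [H1 [H2 _]]. auto. }
  assert (Hcode : forall xs, D xs -> osucc (xs # 0) (xs # 1) (xs # 2) <> 0 ->
    is_code (xs # 0) (pred (osucc (xs # 0) (xs # 1) (xs # 2)))).
  { intros xs [H1 [H2 _]] Hne.
    destruct (osucc_spec _ _ _ H1 H2) as [[E _]|[c [E [Hc _]]]]; [easy|now rewrite E]. }
  set (D' := fun xs => D xs /\ negb (osucc (xs # 0) (xs # 1) (xs # 2) =? 0) = true).
  assert (Hs' : comp 4 D' (fun xs => pred (osucc (xs # 0) (xs # 1) (xs # 2)))).
  { apply comp_pred. destruct Hs as [p Hp]. exists p. intros xs Hk [H _]. auto. }
  assert (Hcode' : forall xs, D' xs ->
    is_code (xs # 0) (pred (osucc (xs # 0) (xs # 1) (xs # 2)))).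
  { intros xs [H1 H2]. apply Hcode; trivial.
    now rewrite negb_true_iff, Nat.eqb_neq in H2. }
  apply compb_and; [auto using compb_neg, compb_zero|]. fold D'. apply compb_and.
  - apply (comp_prog3 _ _ _ (fun d c c' => bool_nat (oincl d c c')) _ _ _ oincl_prog);
      auto using comp_var. intros xs _ H. split; [auto|]. apply H.
  - apply (comp_prog3 _ _ _ (fun d c c' => bool_nat (oincl d c c')) _ _ _ oincl_prog);
      auto using comp_var.
    + destruct Hs' as [p Hp]. exists p. intros xs Hk [H _]. auto.
    + intros xs _ [H _]. split; [apply H|auto].
Qed.

(* State [S i] of the automaton is the [i]-th ideal; the initial state 0 is a copy of
   [S i0] without incoming transitions, which excludes the empty word. *)
Definition source (i0 q : nat) : nat := if q =? 0 then i0 else pred q.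

(** The number [t] is read as [npair q (npair a q')], the coding used in [enc_aut]. The letter is
    tested before [edgeb], whose oracle may diverge outside the alphabet. *)
Definition tranb (d cx i0 n t : nat) : bool :=
  (pfst (psnd t) <? nsig (sys C d)) &&
  ((pfst t <=? n) && ((0 <? psnd (psnd t)) && ((psnd (psnd t) <=? n) &&
   edgeb d (ideal_code d cx (source i0 (pfst t))) (pfst (psnd t))
     (ideal_code d cx (pred (psnd (psnd t))))))).

(** Exceeds the code of every admissible transition, by monotonicity of [npair]. *)
Definition tran_bound (d n : nat) : nat := S (npair n (npair (nsig (sys C d)) n)).

Fixpoint tran_list (d cx i0 n m : nat) : list nat :=
  match m with
  | 0 => []
  | S m' => if tranb d cx i0 n m' then m' :: tran_list d cx i0 n m'
            else tran_list d cx i0 n m'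
  end.

Definition loop_automaton (d cx i0 n : nat) : automaton :=
  mkAut [0] [S i0] (map (fun t => (pfst t, pfst (psnd t), psnd (psnd t)))
    (tran_list d cx i0 n (tran_bound d n))).

(** Built by primitive recursion on the transition codes; [tran_list] lists them in decreasing order
    so that the two agree. *)
Definition loop_automaton_code (d cx i0 n : nat) : nat :=
  npair (S (npair 0 0)) (npair (S (npair (S i0) 0))
    (nat_rect (fun _ => nat) 0
       (fun t r => if tranb d cx i0 n t then S (npair t r) else r) (tran_bound d n))).

Lemma enc_loop_automaton d cx i0 n :
  enc_aut (loop_automaton d cx i0 n) = loop_automaton_code d cx i0 n.
Proof.
  unfold enc_aut, loop_automaton, loop_automaton_code. cbn [a_init a_final a_delta enc_list].
  rewrite map_map. do 2 f_equal.
  rewrite (map_ext _ (fun t => t)), map_id.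
  - induction (tran_bound d n) as [|m IH]; [trivial|].
    simpl. rewrite <- IH. now destruct (tranb d cx i0 n m).
  - intros t. now rewrite !npair_proj.
Qed.

Lemma in_tran_list d cx i0 n m t :
  In t (tran_list d cx i0 n m) <-> t < m /\ tranb d cx i0 n t = true.
Proof.
  induction m as [|m IH]; simpl; [split; [easy|lia]|].
  destruct (tranb d cx i0 n m) eqn:E; simpl; rewrite IH.
  - split.
    + intros [<-|[H1 H2]]; auto.
    + intros [H1 H2]. destruct (Nat.eq_dec m t); [auto|]. right. split; [lia|trivial].
  - split; intros [H1 H2]; (split; [|trivial]); [lia|].
    destruct (Nat.eq_dec t m); [congruence|lia].
Qed.

Lemma in_delta d cx x i0 n q a q' :
  inC C d -> st_of C d cx = Some x ->
  (In (q, a, q') (a_delta (loop_automaton d cx i0 n)) <->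
   a < nsig (sys C d) /\ q <= n /\ 0 < q' /\ q' <= n /\
   cstep (sys C d) a (idl d (ideal_code d cx (source i0 q)))
     (idl d (ideal_code d cx (pred q')))).
Proof.
  intros Hd Hx. destruct (Hclass d Hd) as [_ Hv].
  assert (Hcode : forall m, is_code d (ideal_code d cx m)).
  { intros m. apply ideal_code_is_code. split; eauto. }
  assert (Hid : forall m, is_ideal (sys C d) (idl d (ideal_code d cx m))).
  { intros m. eapply derived_ideal; eauto using ideal_code_derived. }
  unfold loop_automaton. cbn [a_delta]. rewrite in_map_iff. split.
  - intros [t [Et Ht]]. injection Et as <- <- <-. apply in_tran_list in Ht.
    destruct Ht as [_ Ht]. unfold tranb in Ht. rewrite !andb_true_iff in Ht.
    rewrite !Nat.ltb_lt, !Nat.leb_le in Ht. destruct Ht as [Ha [Hq [H0 [Hq' He]]]].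
    apply edgeb_spec in He; auto.
  - intros [Ha [Hq [H0 [Hq' He]]]]. exists (npair q (npair a q')).
    rewrite psnd_npair, !pfst_npair, psnd_npair. split; trivial. apply in_tran_list.
    split.
    + unfold tran_bound. apply Nat.lt_succ_r, npair_le; trivial. apply npair_le; lia.
    + unfold tranb. rewrite !psnd_npair, !pfst_npair, !andb_true_iff, !Nat.ltb_lt, !Nat.leb_le.
      rewrite edgeb_spec; auto.
Qed.

Lemma loop_automaton_over_alphabet d cx i0 n :
  is_state d cx -> over_alphabet (nsig (sys C d)) (loop_automaton d cx i0 n).
Proof.
  intros [Hd [x Hx]] q a q' H. now apply (in_delta d cx x) in H.
Qed.

Lemma loop_automaton_lang d cx x i0 n w :
  inC C d -> st_of C d cx = Some x -> i0 < n ->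
  (in_lang (loop_automaton d cx i0 n) w <->
   w <> [] /\ steps (fun a I J => In J (ideals d cx n) /\ cstep (sys C d) a I J) w
     (idl d (ideal_code d cx i0)) (idl d (ideal_code d cx i0))).
Proof.
  intros Hd Hx Hi0. split.
  - intros [q0 [qf [[<-|[]] [[<-|[]] H]]]].
    split; [intros ->; inversion H|].
    assert (Hgen : forall q r, arun (loop_automaton d cx i0 n) q w r -> r = S i0 ->
      steps (fun a I J => In J (ideals d cx n) /\ cstep (sys C d) a I J) w
        (idl d (ideal_code d cx (source i0 q))) (idl d (ideal_code d cx i0)));
      [|now apply (Hgen 0 (S i0))].
    clear H. intros q r H Er.
    induction H as [q|q a q' w r HIn _ IH]; [now subst q|].
    apply (in_delta d cx x) in HIn; trivial. destruct HIn as [_ [_ [H0 [Hq' He]]]].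
    destruct q' as [|j]; [lia|].
    exists (idl d (ideal_code d cx j)). split; [split; [|exact He]|].
    + apply in_ideals. exists j. auto.
    + exact (IH Er).
  - intros [Hne Hst]. exists 0, (S i0). split; [now left|]. split; [now left|].
    assert (Hgen : forall q, w <> [] -> q <= n ->
      steps (fun a I J => In J (ideals d cx n) /\ cstep (sys C d) a I J) w
        (idl d (ideal_code d cx (source i0 q))) (idl d (ideal_code d cx i0)) ->
      arun (loop_automaton d cx i0 n) q w (S i0));
      [|apply Hgen; [trivial|lia|exact Hst]].
    clear Hne Hst.
    induction w as [|a w IH]; [easy|]. intros q _ Hq [M [[HM He] Hw]].
    assert (Ha : a < nsig (sys C d)).
    { destruct He as [[[z Hz] _] [He _]].
      destruct (He z Hz) as [i [y [_ [[Ha _] _]]]]. trivial. }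
    destruct w as [|b w].
    (* The last transition must enter the final state [S i0] itself, not another index of the same
       ideal. *)
    + simpl in Hw. subst M. apply arun_cons with (S i0); [|constructor].
      apply (in_delta d cx x); trivial. simpl pred. repeat split; trivial; try lia; apply He.
    + apply in_ideals in HM. destruct HM as [j [Hj <-]].
      apply arun_cons with (S j); [|apply IH; trivial; easy].
      apply (in_delta d cx x); trivial. simpl pred. repeat split; trivial; try lia; apply He.
Qed.

Lemma loop_automaton_code_prog : prog4 (fun d cx _ _ => is_state d cx) loop_automaton_code.
Proof.
  set (D := fun xs => is_state (xs # 0) (xs # 1)).
  apply (prog4_comp _ D
    (fun xs => loop_automaton_code (xs # 0) (xs # 1) (xs # 2) (xs # 3))); [|trivial].
  apply comp_npair; [apply comp_const|].
  apply comp_npair; [auto using comp_succ, comp_npair, comp_const, comp_var|].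
  set (D' := fun ys => is_state (ys # 2) (ys # 3)).
  set (T := fun ys => tranb (ys # 2) (ys # 3) (ys # 4) (ys # 5) (ys # 0)).
  apply (comp_loop 4 D D' (fun xs => tran_bound (xs # 0) (xs # 3)) (fun _ => 0)
    (fun ys => if T ys then S (npair (ys # 0) (ys # 1)) else ys # 1)); trivial.
  - apply comp_succ, comp_npair; [apply comp_var|].
    apply comp_npair; [|apply comp_var]. apply comp_nsig; [apply comp_var|].
    now intros xs _ [H _].
  - apply comp_const.
  - apply (compb_if 6 D' T (fun ys => S (npair (ys # 0) (ys # 1))) (fun ys => ys # 1));
      auto using comp_succ, comp_npair, comp_var.
    unfold T, tranb.
    apply compb_and.
    { apply compb_ltb; [auto using comp_pfst, comp_psnd, comp_var|].
      apply comp_nsig; [apply comp_var|]. now intros xs _ [H _]. }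
    apply compb_and; [auto using compb_leb, comp_pfst, comp_var|].
    apply compb_and; [auto using compb_ltb, comp_const, comp_psnd, comp_var|].
    apply compb_and; [auto using compb_leb, comp_psnd, comp_var|].
    apply (comp_prog4 _ _ _ (fun d c a c' => bool_nat (edgeb d c a c')) _ _ _ _ edgeb_prog);
      auto using comp_pfst, comp_psnd, comp_var.
    + apply comp_ideal_code; auto using comp_var.
      * apply (comp_if 6 _ (fun ys => pfst (ys # 0)) (fun ys => pred (pfst (ys # 0)))
          (fun ys => ys # 4)); auto using comp_pred, comp_pfst, comp_var.
      * now intros xs _ [[[[H _] _] _] _].
    + apply comp_ideal_code; auto using comp_pred, comp_psnd, comp_var.
      now intros xs _ [[[[H _] _] _] _].
    + intros xs _ [[[[H Ha] _] _] _]. apply Nat.ltb_lt in Ha.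
      auto using ideal_code_is_code.
Qed.

(** [R] evaluates the criterion of [repeatedly_coverable_iff] on the first [size d cx] ideals.
    Membership of [y] becomes inclusion of the ideal below [y], a test available on codes. *)
Lemma oracles_decide : repeated_coverability_decidable C.
Proof.
  destruct (prog_least is_state closedb closedb_prog closedb_exists) as [size [Hsize Hclosed]].
  set (R := fun d cx cy => bex (size d cx) (fun i =>
    oincl d (odown d cy) (ideal_code d cx i) &&
    opos d (loop_automaton_code d cx i (size d cx)))).
  assert (HR : compb 3 (fun xs => is_state (xs # 0) (xs # 1) /\ is_state (xs # 0) (xs # 2))
    (fun xs => R (xs # 0) (xs # 1) (xs # 2))).
  { set (D := fun ys => is_state (ys # 1) (ys # 2) /\ is_state (ys # 1) (ys # 3)).
    apply (compb_bex 3 _ D (fun xs => size (xs # 0) (xs # 1))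
      (fun ys => oincl (ys # 1) (odown (ys # 1) (ys # 3)) (ideal_code (ys # 1) (ys # 2) (ys # 0))
        && opos (ys # 1) (loop_automaton_code (ys # 1) (ys # 2) (ys # 0)
             (size (ys # 1) (ys # 2))))); trivial.
    { apply (comp_prog2 _ _ _ size _ _ Hsize); auto using comp_var. now intros xs _ [H _]. }
    apply compb_and.
    - apply (comp_prog3 _ _ _ (fun d c c' => bool_nat (oincl d c c')) _ _ _ oincl_prog);
        auto using comp_var.
      + apply (comp_prog2 _ _ _ odown _ _ odown_prog); auto using comp_var.
        now intros xs _ [_ H].
      + apply comp_ideal_code; auto using comp_var. now intros xs _ [H _].
      + intros xs _ [H [Hd [y Hy]]]. split; [|auto using ideal_code_is_code].
        now apply (odown_spec _ _ y).
    - apply (comp_prog2 _ _ _ (fun d cA => bool_nat (opos d cA)) _ _ opos_prog);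
        auto using comp_var.
      + apply (comp_prog4 _ _ _ loop_automaton_code _ _ _ _ loop_automaton_code_prog);
          auto using comp_var.
        * apply (comp_prog2 _ _ _ size _ _ Hsize); auto using comp_var.
          now intros xs _ [[H _] _].
        * now intros xs _ [[H _] _].
      + intros xs _ [[H _] _]. split; [apply H|].
        eexists. split; [|apply enc_loop_automaton].
        now apply loop_automaton_over_alphabet. }
  destruct HR as [p Hp]. exists p. intros d Hd cx cy x y Hx Hy.
  assert (Hsx : is_state d cx) by (split; eauto).
  assert (Hsy : is_state d cy) by (split; eauto).
  specialize (Hp [d; cx; cy] eq_refl (conj Hsx Hsy)). simpl in Hp.
  cut (repeatedly_coverable (sys C d) x y <-> R d cx cy = true).
  { intros H. destruct (R d cx cy); simpl in Hp; [left|right]; intuition discriminate. }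
  destruct (Hclass d Hd) as [Hpos Hv].
  destruct (closedb_sound d cx x _ Hd Hx (Hclosed d cx Hsx)) as [Hroot Hcl].
  rewrite (repeatedly_coverable_iff _ Hv x y (ideals d cx (size d cx))); trivial.
  2:{ intros K HK. apply in_ideals in HK. destruct HK as [i [_ <-]].
      now apply ideal_code_derived. }
  destruct (odown_spec d cy y Hd Hy) as [Hcy Edown].
  assert (Hiff : forall i, i < size d cx ->
    (oincl d (odown d cy) (ideal_code d cx i) &&
       opos d (loop_automaton_code d cx i (size d cx)) = true <->
     idl d (ideal_code d cx i) y /\
     exists w, w <> [] /\ positive_word (sys C d) w /\
       steps (fun a I J => In J (ideals d cx (size d cx)) /\ cstep (sys C d) a I J) w
         (idl d (ideal_code d cx i)) (idl d (ideal_code d cx i)))).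
  { intros i Hi. rewrite andb_true_iff, oincl_spec by auto using ideal_code_is_code.
    rewrite Edown, <- enc_loop_automaton, opos_spec
      by auto using loop_automaton_over_alphabet.
    assert (HiI := derived_ideal _ Hv _ _ (ideal_code_derived d cx x i Hd Hx)).
    assert (Hbelow : incl (below (sys C d) y) (idl d (ideal_code d cx i)) <->
      idl d (ideal_code d cx i) y).
    { split; intros H.
      - apply H, (le_refl _ (proj1 (proj1 Hv))).
      - intros z Hz. now apply (ideal_down_closed _ _ HiI z y). }
    rewrite Hbelow. split; intros [H1 [w H2]]; (split; [trivial|]); exists w.
    - rewrite (loop_automaton_lang d cx x) in H2 by trivial. tauto.
    - rewrite (loop_automaton_lang d cx x) by trivial. tauto. }
  unfold R. rewrite bex_spec. split.
  - intros [K [HK H]]. apply in_ideals in HK. destruct HK as [i [Hi <-]].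
    exists i. split; trivial. now apply Hiff.
  - intros [i [Hi H]]. apply Hiff in H; trivial. eexists. split; [|exact H].
    apply in_ideals. eauto.
Qed.

End Decision.

(** * Oracle functions from the effectiveness hypotheses *)

Lemma choice_on {A : Type} (E : A -> Prop) (Q : A -> nat -> Prop) :
  (forall a, E a -> exists n, Q a n) -> exists h, forall a, E a -> Q a (h a).
Proof.
  intros H. apply (choice (fun a n => E a -> Q a n)). intros a.
  destruct (classic (E a)) as [Ha|Ha]; [|exists 0; easy].
  destruct (H a Ha) as [n Hn]. eauto.
Qed.

Theorem theorem18 (C : ts_class) :
  (forall d, inC C d -> positive_ts (sys C d) /\ very_wsts (sys C d)) ->
  completion_post_effective C ->
  infinity_completion_effective C ->
  positive_effective C ->
  repeated_coverability_decidable C.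
Proof.
  intros Hclass [_ [Hsig [[pd Hd] [[pi Hi] [ps Hs]]]]] [pf Hf] [pp Hp].
  assert (Hidl : forall d c I, idl_of C d c = Some I -> idl C d c = I)
    by (intros d c I H; unfold idl; now rewrite H).
  assert (Hcode : forall d c, is_code C d c -> idl_of C d c = Some (idl C d c))
    by (intros d c [_ [I H]]; unfold idl; now rewrite H).
  (* The hypotheses only say that a program has some output with the right property; choice fixes
     the output as a function, with arbitrary values off the domain. *)
  destruct (choice_on (fun t => is_state C (fst t) (snd t))
    (fun t c => eval pd [fst t; snd t] c /\ forall x, st_of C (fst t) (snd t) = Some x ->
       is_code C (fst t) c /\ idl C (fst t) c = below (sys C (fst t)) x)) as [odown Hdown].
  { intros [d cx] [HC [x Hx]]. simpl in *.
    destruct (Hd d HC cx x Hx) as [c [I [Hev [HI [H1 H2]]]]]. exists c. split; trivial.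
    intros x' Hx'. split; [split; eauto|]. rewrite (Hidl _ _ _ HI).
    assert (x' = x) as -> by congruence. now apply set_ext. }
  destruct (choice_on
    (fun t => is_code C (fst t) (fst (snd t)) /\ is_code C (fst t) (snd (snd t)))
    (fun t r => exists b, r = bool_nat b /\ eval pi [fst t; fst (snd t); snd (snd t)] r /\
       (b = true <-> incl (idl C (fst t) (fst (snd t))) (idl C (fst t) (snd (snd t))))))
    as [oincl Hincl].
  { intros [d [c c']] [H1 H2]. simpl in *.
    destruct (Hi d (proj1 H1) c c' _ _ (Hcode _ _ H1) (Hcode _ _ H2)) as [[H3 H4]|[H3 H4]].
    - exists 1, true. simpl. tauto.
    - exists 0, false. simpl. repeat split; trivial; [discriminate|contradiction]. }
  destruct (choice_on
    (fun t => is_code C (fst t) (fst (snd t)) /\ snd (snd t) < nsig (sys C (fst t)))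
    (fun t r => eval ps [fst t; fst (snd t); snd (snd t)] r /\
       ((r = 0 /\ ~ exists J, cstep (sys C (fst t)) (snd (snd t))
                                (idl C (fst t) (fst (snd t))) J) \/
        (exists c', r = S c' /\ is_code C (fst t) c' /\
           cstep (sys C (fst t)) (snd (snd t)) (idl C (fst t) (fst (snd t)))
             (idl C (fst t) c'))))) as [osucc Hsucc].
  { intros [d [c a]] [H1 H2]. simpl in *.
    destruct (Hs d (proj1 H1) c _ a (Hcode _ _ H1) H2) as [[H3 H4]|[c' [J [H3 [H4 H5]]]]].
    - exists 0. auto.
    - exists (S c'). split; trivial. right. exists c'. split; trivial.
      rewrite (Hidl _ _ _ H4). split; trivial. split; [apply H1|eauto]. }
  (* The function sees only the code of a word, so its specification ranges over all words with that
     code; injectivity of [enc_list] leaves just one. *)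
  destruct (choice_on
    (fun t => is_code C (fst t) (fst (snd t)) /\ is_word C (fst t) (snd (snd t)))
    (fun t r => eval pf [fst t; fst (snd t); snd (snd t)] r /\
       forall w, enc_list w = snd (snd t) -> is_code C (fst t) r /\
         winf (sys C (fst t)) w (idl C (fst t) (fst (snd t))) (idl C (fst t) r)))
    as [oinf Hinf].
  { intros [d [c cw]] [H1 [w [<- H2]]]. simpl in *.
    destruct (Hf d (proj1 H1) c _ w (Hcode _ _ H1) H2) as [c' [J [H3 [H4 H5]]]].
    exists c'. split; trivial. intros w' Hw'. apply enc_list_inj in Hw'. subst w'.
    rewrite (Hidl _ _ _ H4). split; trivial. split; [apply H1|eauto]. }
  destruct (choice_on
    (fun t => inC C (fst t) /\ exists A, over_alphabet (nsig (sys C (fst t))) A /\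
       enc_aut A = snd t)
    (fun t r => exists b, r = bool_nat b /\ eval pp [fst t; snd t] r /\
       forall A, enc_aut A = snd t ->
         (b = true <-> exists w, in_lang A w /\ positive_word (sys C (fst t)) w)))
    as [opos Hpos].
  { intros [d cA] [H1 [A [H2 <-]]]. simpl in *.
    destruct (Hp d H1 A H2) as [[H3 H4]|[H3 H4]]; [exists 1, true|exists 0, false];
      (split; [reflexivity|]); (split; [trivial|]); intros B HB;
      apply enc_aut_inj in HB; subst B.
    - tauto.
    - split; [discriminate|contradiction]. }
  apply (oracles_decide C (fun d c a => osucc (d, (c, a))) (fun d c cw => oinf (d, (c, cw)))
    (fun d c c' => negb (oincl (d, (c, c')) =? 0)) (fun d cx => odown (d, cx))
    (fun d cA => negb (opos (d, cA) =? 0))); trivial.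
  - exists pd. intros d cx H. exact (proj1 (Hdown (d, cx) H)).
  - intros d cx x HC Hx. apply (proj2 (Hdown (d, cx) (conj HC (ex_intro _ x Hx))) x Hx).
  - exists pi. intros d c c' H.
    destruct (Hincl (d, (c, c')) H) as [b [E [Hev _]]]. simpl in Hev. rewrite E in *.
    now destruct b.
  - intros d c c' H1 H2.
    destruct (Hincl (d, (c, c')) (conj H1 H2)) as [b [E [_ H]]]. simpl in H. rewrite E.
    now destruct b.
  - exists ps. intros d c a H. exact (proj1 (Hsucc (d, (c, a)) H)).
  - intros d c a H1 H2. exact (proj2 (Hsucc (d, (c, a)) (conj H1 H2))).
  - exists pf. intros d c cw H. exact (proj1 (Hinf (d, (c, cw)) H)).
  - intros d c w H1 H2.
    exact (proj2 (Hinf (d, (c, enc_list w)) (conj H1 H2)) w eq_refl).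
  - exists pp. intros d cA H.
    destruct (Hpos (d, cA) H) as [b [E [Hev _]]]. simpl in Hev. rewrite E in *.
    now destruct b.
  - intros d A HC HA. destruct (Hpos (d, enc_aut A)) as [b [E [_ H]]].
    + split; [trivial|now exists A].
    + rewrite E. specialize (H A eq_refl). now destruct b.
Qed.
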